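(* Let $\mathbb K$ be a discrete field. For every topological flow $(V,\phi)$ over $\mathbb K$ one has $$\mathrm{ent}^*(V,\phi)=\mathrm{cork}(V,\phi).$$
   Context: A Hausdorff topological $\mathbb K$-space is linearly topologized if it has a neighbourhood basis at $0$ consisting of $\mathbb K$-subspaces; it is linearly compact if moreover any collection of closed linear varieties with the finite intersection property has non-empty intersection. A topological flow is a pair $(V,\phi)$ with $V$ a linearly compact $\mathbb K$-space and $\phi$ a continuous linear endomorphism of $V$. A subspace $Z$ is $\phi$-invariant if $\phi(Z)\subseteq Z$. The topological entropy is $\mathrm{ent}^*(V,\phi)=\sup_U\lim_{n\to\infty}\frac1n\dim_{\mathbb K}\big(U/(U\cap\phi^{-1}U\cap\cdots\cap\phi^{-n+1}U)\big)\in\mathbb N\cup\{\infty\}$, with $U$ ranging over the linearly compact open subspaces of $V$. A topological flow $(V,\phi)$ has completely positive topological entropy if $\mathrm{ent}^*(V/Z,\overline\phi)\neq0$ for every proper closed $\phi$-invariant subspace $Z$ of $V$, $\overline\phi$ being induced by $\phi$. $D_+(V,\phi)$ is the largest closed $\phi$-invariant subspace of $V$ such that $(D_+(V,\phi),\phi\restriction_{D_+(V,\phi)})$ has completely positive topological entropy; equivalently, it is the intersection of all closed $\phi$-invariant subspaces $Z$ of $V$ with $\mathrm{ent}^*(V/Z,\overline\phi)=0$. For a topological flow $(X,\rho)$, let $\Lambda(X,\rho)$ be the modular lattice (with operations $+$ and $\cap$) of all closed $\rho$-invariant subspaces of $X$. A finite set $\{N_i\mid i\in I\}$ of proper elements of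 $\Lambda(X,\rho)$ is coindependent if $N_i+\bigcap_{j\neq i}N_j=X$ for all $i\in I$ (an empty intersection being $X$); an arbitrary set is coindependent if all its finite subsets are. The dual Goldie dimension of $\Lambda(X,\rho)$ is $\infty$ if it contains an infinite coindependent set, and otherwise is the maximal cardinality of a finite coindependent set. The corank $\mathrm{cork}(V,\phi)$ is the dual Goldie dimension of $\Lambda(D_+(V,\phi),\phi\restriction_{D_+(V,\phi)})$. *)

(* Defs.v *)
From HB Require Import structures.
From mathcomp Require Import all_boot all_order all_algebra.
From mathcomp Require Import generic_quotient ring_quotient vector finmap.
From mathcomp Require Import all_classical all_reals all_analysis.

Set Implicit Arguments.
Unset Strict Implicit.
Unset Printing Implicit Defensive.

Import Order.TTheory GRing.Theory Num.Theory.
Local Open Scope classical_set_scope.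
Local Open Scope ring_scope.
Local Open Scope quotient_scope.

(* The library's topological modules take their scalars in a [numDomainType];
   over an arbitrary field, with its discrete topology, a topological vector
   space is built here on top of [topologicalZmodType]. *)
Record topVect (K : fieldType) := TopVect {
  tv_zmod : topologicalZmodType;
  tv_scale : K -> tv_zmod -> tv_zmod;
  tv_scaleA : forall a b v, tv_scale a (tv_scale b v) = tv_scale (a * b) v;
  tv_scale1 : left_id 1 tv_scale;
  tv_scaleDr : right_distributive tv_scale +%R;
  tv_scaleDl : forall v, {morph tv_scale^~ v : a b / a + b};
  tv_scale_continuous :
    continuous (fun z : discrete_topology K * tv_zmod => tv_scale z.1 z.2)
}.

Definition tv_sort (K : fieldType) (V : topVect K) : Type := tv_zmod V.
Coercion tv_sort : topVect >-> Sortclass.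

HB.instance Definition _ (K : fieldType) (V : topVect K) :=
  TopologicalZmodule.on (tv_sort V).
HB.instance Definition _ (K : fieldType) (V : topVect K) :=
  GRing.Zmodule_isLmodule.Build K (tv_sort V) (@tv_scaleA K V)
    (@tv_scale1 K V) (@tv_scaleDr K V) (@tv_scaleDl K V).

Section LSubspace.
Variables (K : fieldType) (V : lmodType K).

Record lsubspace := LSubspace {
  subspace_set :> set V;
  subspaceP : submod_closed (fun x : V => x \in subspace_set)
}.

HB.instance Definition _ := gen_eqMixin lsubspace.
HB.instance Definition _ := gen_choiceMixin lsubspace.

Lemma subspace_ext (U W : lsubspace) : (U : set V) = W -> U = W.
Proof.
by case: U W => [U hU] [W hW] /= e; subst W; congr LSubspace; exact: Prop_irrelevance.
Qed.

Definition subspace_pred (U : lsubspace) : {pred V} :=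
  fun x => x \in (U : set V).

HB.instance Definition _ (U : lsubspace) :=
  GRing.isSubmodClosed.Build K V (subspace_pred U) (subspaceP U).

Lemma subspace_predE (U : lsubspace) x : (x \in subspace_pred U) = (x \in (U : set V)).
Proof. by []. Qed.

Lemma subspace0 (U : lsubspace) : (U : set V) 0.
Proof. by apply/set_mem; exact: (rpred0 (subspace_pred U)). Qed.

Lemma subspaceD (U : lsubspace) x y :
  (U : set V) x -> (U : set V) y -> (U : set V) (x + y).
Proof.
by move=> /mem_set Ux /mem_set Uy; apply/set_mem; exact: (@rpredD _ (subspace_pred U)).
Qed.

Lemma subspaceZ (U : lsubspace) a x : (U : set V) x -> (U : set V) (a *: x).
Proof. by move=> /mem_set Ux; apply/set_mem; exact: (@rpredZ _ _ (subspace_pred U)). Qed.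

Lemma subspaceN (U : lsubspace) x : (U : set V) x -> (U : set V) (- x).
Proof. by rewrite -scaleN1r; exact: subspaceZ. Qed.

Lemma subspaceB (U : lsubspace) x y :
  (U : set V) x -> (U : set V) y -> (U : set V) (x - y).
Proof. by move=> Ux /subspaceN; exact: subspaceD. Qed.

Lemma mk_subspace_subproof (A : set V) :
  A 0 -> (forall a x y, A x -> A y -> A (a *: x + y)) ->
  submod_closed (fun x : V => x \in A).
Proof.
move=> A0 AD; split; first exact/mem_set.
by move=> a x y /set_mem Ax /set_mem Ay; apply/mem_set; exact: AD.
Qed.

Definition mk_subspace (A : set V) A0 AD : lsubspace :=
  LSubspace (@mk_subspace_subproof A A0 AD).

Lemma full_subproof a x y : setT x -> setT y -> [set: V] (a *: x + y).
Proof. by []. Qed.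

Definition full_subspace : lsubspace := @mk_subspace setT I full_subproof.

Definition linear_variety (A : set V) : Prop :=
  exists v (W : lsubspace), A = [set v + w | w in W].

End LSubspace.

Section PreimageSubspace.
Variables (K : fieldType) (V W : lmodType K) (f : {linear V -> W}).
Variable U : lsubspace W.

Lemma preim_subspace_subproof a x y :
  (f @^-1` U) x -> (f @^-1` U) y -> (f @^-1` U) (a *: x + y).
Proof.
by move=> Ux Uy; rewrite /= linearP; apply: subspaceD => //; exact: subspaceZ.
Qed.

Lemma preim_subspace0 : (f @^-1` U) 0.
Proof. by rewrite /= linear0; exact: subspace0. Qed.

Definition preim_subspace : lsubspace V :=
  mk_subspace preim_subspace0 preim_subspace_subproof.

End PreimageSubspace.

Section BigcapSubspace.
Variables (K : fieldType) (V : lmodType K) (U : nat -> lsubspace V) (n : nat).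

Lemma cap_subspace0 : (\bigcap_(i in `I_n) (U i : set V)) 0.
Proof. by move=> i _; exact: subspace0. Qed.

Lemma cap_subspace_subproof a x y :
  (\bigcap_(i in `I_n) (U i : set V)) x ->
  (\bigcap_(i in `I_n) (U i : set V)) y ->
  (\bigcap_(i in `I_n) (U i : set V)) (a *: x + y).
Proof.
move=> Ux Uy i ni; apply: subspaceD; last exact: Uy.
by apply: subspaceZ; exact: Ux.
Qed.

Definition cap_subspace : lsubspace V :=
  mk_subspace cap_subspace0 cap_subspace_subproof.

End BigcapSubspace.

Section TopVectTheory.
Variables (K : fieldType) (V : topVect K).

Lemma addl_continuous (v : V) : continuous (fun x : V => v + x).
Proof.
move=> x; apply: (@continuous_comp _ _ _ (fun x : V => (v, x))
  (fun z : V * V => z.1 + z.2)); last exact: add_continuous.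
by apply: cvg_pair; [exact: cvg_cst | exact: cvg_id].
Qed.

Lemma open_translate (v : V) (A : set V) : open A -> open [set v + x | x in A].
Proof.
move=> oA; have -> : [set v + x | x in A] = (fun x => - v + x) @^-1` A.
  apply/seteqP; split=> [_ [x Ax <-]|x Ax] /=; first by rewrite addKr.
  by exists (- v + x) => //; rewrite addNKr.
by move/continuousP: (@addl_continuous (- v)); exact.
Qed.

Lemma nbhs_translate (v : V) (A : set V) :
  nbhs v A -> nbhs (0 : V) [set - v + x | x in A].
Proof.
rewrite nbhsE => -[B [oB Bv] BA]; rewrite nbhsE.
exists [set - v + x | x in B]; last exact: image_subset.
by split; [exact: open_translate | exists v; rewrite ?addNr].
Qed.

Lemma subspace_nbhs_open (U : lsubspace V) : nbhs (0 : V) U -> open (U : set V).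
Proof.
rewrite nbhsE => -[B [oB B0] BU].
have -> : (U : set V) = \bigcup_(u in U) [set u + x | x in B].
  apply/seteqP; split=> [u Uu|_ [u Uu [x Bx <-]]].
    by exists u => //; exists 0; rewrite ?addr0.
  by apply: subspaceD => //; exact: BU.
by apply: bigcup_open => u _; exact: open_translate.
Qed.

End TopVectTheory.

Section SubspaceType.
Variables (K : fieldType) (V : topVect K) (U : lsubspace V).

Definition subsp : Type := set_type (U : set V).

HB.instance Definition _ := Topological.on subsp.
HB.instance Definition _ := [isSub of subsp for @sval _ _].
HB.instance Definition _ :=
  GRing.SubChoice_isSubLmodule.Build K V (subspace_pred U) subsp (subspaceP U).

Definition subsp_val : subsp -> V := val.

Lemma subsp_val_linear : linear subsp_val.
Proof. by move=> a x y. Qed.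

HB.instance Definition _ :=
  GRing.isLinear.Build K subsp V _ subsp_val subsp_val_linear.

Lemma subsp_val_continuous : continuous subsp_val.
Proof. exact: (@initial_continuous (set_type U) V set_val). Qed.

Lemma subsp_valP (x : subsp) : (U : set V) (subsp_val x).
Proof. by apply/set_mem; case: x. Qed.

Lemma subsp_val_inj : injective subsp_val.
Proof. exact: val_inj. Qed.

Lemma subsp_continuous (T : topologicalType) (f : T -> subsp) :
  continuous (subsp_val \o f) -> continuous f.
Proof.
move=> /continuousP cf; apply/continuousP => _ [A oA <-].
exact: (cf A oA).
Qed.

Lemma subsp_add_continuous : continuous (fun x : subsp * subsp => x.1 + x.2).
Proof.
apply: subsp_continuous => x.
apply: (@continuous_comp _ _ _
  (fun x : subsp * subsp => (subsp_val x.1, subsp_val x.2))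
  (fun z : V * V => z.1 + z.2)); last exact: add_continuous.
apply: cvg_pair.
  by apply: (@continuous_comp _ _ _ (fun p : subsp * subsp => p.1) subsp_val);
    [exact: cvg_fst | exact: subsp_val_continuous].
by apply: (@continuous_comp _ _ _ (fun p : subsp * subsp => p.2) subsp_val);
    [exact: cvg_snd | exact: subsp_val_continuous].
Qed.

Lemma subsp_opp_continuous : continuous (-%R : subsp -> subsp).
Proof.
apply: subsp_continuous => x.
apply: (@continuous_comp _ _ _ subsp_val (-%R : V -> V)).
  exact: subsp_val_continuous.
exact: opp_continuous.
Qed.

Lemma subsp_scale_continuous :
  continuous (fun z : discrete_topology K * subsp => (z.1 : K) *: z.2).
Proof.
apply: subsp_continuous => x.
apply: (@continuous_comp _ _ _
  (fun x : discrete_topology K * subsp => (x.1, subsp_val x.2))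
  (fun z : discrete_topology K * V => (z.1 : K) *: z.2)).
  apply: (@cvg_pair _ _ _ _ (nbhs (x.1 : discrete_topology K))); first exact: cvg_fst.
  by apply: (@continuous_comp _ _ _
    (fun p : discrete_topology K * subsp => p.2) subsp_val);
    [exact: cvg_snd | exact: subsp_val_continuous].
exact: (@tv_scale_continuous K V).
Qed.

HB.instance Definition _ :=
  PreTopologicalNmodule_isTopologicalNmodule.Build subsp subsp_add_continuous.
HB.instance Definition _ :=
  TopologicalNmodule_isTopologicalZmodule.Build subsp subsp_opp_continuous.

Definition sub_topvect : topVect K :=
  TopVect (tv_zmod := subsp) (@scalerA K subsp) (@scale1r K subsp)
    (@scalerDr K subsp) (@scalerDl K subsp) subsp_scale_continuous.

End SubspaceType.

Section QuotientType.
Variables (K : fieldType) (V : topVect K) (Z : lsubspace V).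

Definition quotsp : Type := quotient_topology {ideal_quot (subspace_pred Z)}.

HB.instance Definition _ := Topological.on quotsp.
HB.instance Definition _ := GRing.isZmodule.Build quotsp
  (@Quotient.addqA _ (subspace_pred Z)) (@Quotient.addqC _ (subspace_pred Z))
  (@Quotient.add0q _ (subspace_pred Z)) (@Quotient.addNq _ (subspace_pred Z)).

Definition quotsp_pi (v : V) : quotsp := \pi_{ideal_quot (subspace_pred Z)} v.

Definition quotsp_repr (q : quotsp) : V :=
  repr (q : {ideal_quot (subspace_pred Z)}).

Lemma quotsp_reprK : cancel quotsp_repr quotsp_pi.
Proof. by move=> q; rewrite /quotsp_pi reprK. Qed.

Lemma quotsp_piE (v w : V) : (quotsp_pi v = quotsp_pi w) <-> (Z : set V) (v - w).
Proof.
split=> [e|/mem_set Zvw].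
  apply/set_mem; rewrite -subspace_predE.
  by rewrite (Quotient.idealrBE (subspace_pred Z)); apply/eqP.
have : v == w %[mod {ideal_quot (subspace_pred Z)}].
  by rewrite -(Quotient.idealrBE (subspace_pred Z)).
by move=> /eqP.
Qed.

Lemma quotsp_piD (v w : V) : quotsp_pi (v + w) = quotsp_pi v + quotsp_pi w.
Proof. by rewrite /quotsp_pi; exact: (Quotient.pi_add (subspace_pred Z)). Qed.

Lemma quotsp_piN (v : V) : quotsp_pi (- v) = - quotsp_pi v.
Proof. by rewrite /quotsp_pi; exact: (Quotient.pi_opp (subspace_pred Z)). Qed.

Lemma quotsp_pi_continuous : continuous quotsp_pi.
Proof. exact: (@pi_continuous V {ideal_quot (subspace_pred Z)}). Qed.

Lemma quotsp_openE (A : set quotsp) : open A = open (quotsp_pi @^-1` A).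
Proof. by []. Qed.

Lemma quotsp_pi_saturation (A : set V) :
  quotsp_pi @^-1` (quotsp_pi @` A) = \bigcup_(z in Z) [set z + x | x in A].
Proof.
apply/seteqP; split=> [v [x Ax /esym/quotsp_piE Zvx]|_ [z Zz [x Ax <-]]].
  by exists (v - x) => //; exists x => //; rewrite subrK.
by exists x => //; apply/quotsp_piE; rewrite opprD addrCA subrr addr0; exact: subspaceN.
Qed.

Lemma quotsp_pi_open (A : set V) : open A -> open (quotsp_pi @` A).
Proof.
move=> oA; rewrite quotsp_openE quotsp_pi_saturation.
by apply: bigcup_open => z _; exact: open_translate.
Qed.

Lemma quotsp_pi_nbhs (v : V) (A : set V) :
  nbhs v A -> nbhs (quotsp_pi v) (quotsp_pi @` A).
Proof.
rewrite !nbhsE => -[B [oB Bv] BA]; exists (quotsp_pi @` B); last exact: image_subset.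
by split; [exact: quotsp_pi_open | exists v].
Qed.

Lemma quotsp_add_continuous : continuous (fun x : quotsp * quotsp => x.1 + x.2).
Proof.
move=> [p q] A /=; rewrite -(quotsp_reprK p) -(quotsp_reprK q) -quotsp_piD.
set v := quotsp_repr p; set w := quotsp_repr q => nA.
have /quotsp_pi_continuous nB : nbhs (quotsp_pi (v + w)) A by [].
have [[B C] /= [nvB nwC] BC] := @add_continuous V (v, w) _ nB.
exists (quotsp_pi @` B, quotsp_pi @` C); first by split; exact: quotsp_pi_nbhs.
move=> [_ _] /= [[x Bx <-] [y Cy <-]]; rewrite -quotsp_piD.
by apply: (BC (x, y)).
Qed.

Lemma quotsp_opp_continuous : continuous (-%R : quotsp -> quotsp).
Proof.
move=> p A; rewrite -(quotsp_reprK p) -quotsp_piN => nA.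
have /quotsp_pi_continuous nB : nbhs (quotsp_pi (- quotsp_repr p)) A by [].
have /quotsp_pi_nbhs := @opp_continuous V (quotsp_repr p) _ nB.
by apply: filterS => _ [x Bx <-]; rewrite /= -quotsp_piN.
Qed.

HB.instance Definition _ :=
  PreTopologicalNmodule_isTopologicalNmodule.Build quotsp quotsp_add_continuous.
HB.instance Definition _ :=
  TopologicalNmodule_isTopologicalZmodule.Build quotsp quotsp_opp_continuous.

Definition quotsp_scale (a : K) (q : quotsp) : quotsp :=
  quotsp_pi (a *: quotsp_repr q).

Lemma quotsp_piZ a v : quotsp_pi (a *: v) = quotsp_scale a (quotsp_pi v).
Proof.
apply/quotsp_piE; rewrite -scalerBr; apply: subspaceZ.
by apply/quotsp_piE; rewrite quotsp_reprK.
Qed.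

Lemma quotsp_scaleA a b q :
  quotsp_scale a (quotsp_scale b q) = quotsp_scale (a * b) q.
Proof. by rewrite -(quotsp_reprK q) -!quotsp_piZ scalerA. Qed.

Lemma quotsp_scale1 : left_id 1 quotsp_scale.
Proof. by move=> q; rewrite -(quotsp_reprK q) -!quotsp_piZ scale1r. Qed.

Lemma quotsp_scaleDr : right_distributive quotsp_scale +%R.
Proof.
move=> a p q; rewrite -(quotsp_reprK p) -(quotsp_reprK q).
by rewrite -quotsp_piD -!quotsp_piZ -quotsp_piD scalerDr.
Qed.

Lemma quotsp_scaleDl q : {morph quotsp_scale^~ q : a b / a + b}.
Proof.
move=> a b /=; rewrite -(quotsp_reprK q).
by rewrite -!quotsp_piZ -quotsp_piD scalerDl.
Qed.

Lemma quotsp_scale_continuous :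
  continuous (fun z : discrete_topology K * quotsp => quotsp_scale z.1 z.2).
Proof.
move=> [a p] A /=; rewrite -(quotsp_reprK p) -quotsp_piZ.
set v := quotsp_repr p => nA.
have /quotsp_pi_continuous nB : nbhs (quotsp_pi (a *: v)) A by [].
have [[B C] /= [naB nvC] BC] := @tv_scale_continuous K V (a, v) _ nB.
exists (B, quotsp_pi @` C); first by split=> //; exact: quotsp_pi_nbhs.
move=> [b _] /= [Bb [y Cy <-]]; rewrite -quotsp_piZ.
by apply: (BC (b, y)).
Qed.

Definition quot_topvect : topVect K :=
  TopVect (tv_zmod := quotsp) quotsp_scaleA quotsp_scale1 quotsp_scaleDr
    quotsp_scaleDl quotsp_scale_continuous.

Definition quot_pi : V -> quot_topvect := quotsp_pi.

Lemma quot_pi_linear : linear quot_pi.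
Proof. by move=> a x y; rewrite /quot_pi quotsp_piD quotsp_piZ. Qed.

HB.instance Definition _ :=
  GRing.isLinear.Build K V quot_topvect _ quot_pi quot_pi_linear.

End QuotientType.

Section LinearlyCompact.
Variable K : fieldType.

Definition linearly_topologized (V : topVect K) : Prop :=
  hausdorff_space V /\
  forall A : set V, nbhs (0 : V) A ->
    exists U : lsubspace V, nbhs (0 : V) U /\ (U : set V) `<=` A.

Definition linearly_compact (V : topVect K) : Prop :=
  linearly_topologized V /\
  forall C : set (set V),
    (forall A, C A -> closed A /\ linear_variety A) ->
    finI C id -> \bigcap_(A in C) A !=set0.

End LinearlyCompact.

Section LinearlyCompactTheory.
Variables (K : fieldType) (V : topVect K) (Z : lsubspace V).

Definition sub_val : sub_topvect Z -> V := @subsp_val K V Z.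

Lemma sub_val_linear : linear sub_val.
Proof. by move=> a x y. Qed.

HB.instance Definition _ :=
  GRing.isLinear.Build K (sub_topvect Z) V _ sub_val sub_val_linear.

Lemma image_subspace_proof (W : lsubspace (sub_topvect Z)) a x y :
  (sub_val @` W) x -> (sub_val @` W) y -> (sub_val @` W) (a *: x + y).
Proof.
move=> [u Wu <-] [v Wv <-]; exists (a *: u + v); last by rewrite linearP.
by apply: subspaceD => //; exact: subspaceZ.
Qed.

Lemma image_subspace0 (W : lsubspace (sub_topvect Z)) : (sub_val @` W) 0.
Proof. by exists 0; [exact: subspace0 | rewrite linear0]. Qed.

Definition image_subspace (W : lsubspace (sub_topvect Z)) : lsubspace V :=
  mk_subspace (image_subspace0 W) (@image_subspace_proof W).

Hypothesis cZ : closed (Z : set V).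

Lemma sub_linearly_topologized :
  linearly_topologized V -> linearly_topologized (sub_topvect Z).
Proof.
move=> [hV bV]; split.
  move=> p q pq; apply: (@subsp_val_inj K V Z); apply: hV => A B nA nB.
  have nA' := @subsp_val_continuous K V Z p _ nA.
  have nB' := @subsp_val_continuous K V Z q _ nB.
  by have [x [Ax Bx]] := pq _ _ nA' nB'; exists (subsp_val x).
move=> A; rewrite {1}nbhsE => -[_ [[B oB <-] B0] BA].
have [U [nU UB]] : exists U : lsubspace V, nbhs (0 : V) U /\ (U : set V) `<=` B.
  by apply: bV; apply: open_nbhs_nbhs; split.
exists (preim_subspace sub_val U); split; last first.
  by move=> x /= Ux; apply: BA; apply: UB.
exact: (@subsp_val_continuous K V Z (0 : subsp Z) (U : set V) nU).
Qed.

Lemma sub_linearly_compact : linearly_compact V -> linearly_compact (sub_topvect Z).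
Proof.
move=> [/sub_linearly_topologized tV cV]; split=> // C hC fC.
have [->|/set0P[A0 CA0]] := eqVneq C set0.
  by rewrite bigcap_set0; exists 0.
pose C' := [set sub_val @` A | A in C].
have hC' B : C' B -> closed B /\ linear_variety B.
  move=> [A /hC[cA [v [W AE]]] <-]; split; last first.
    exists (sub_val v), (image_subspace W); rewrite AE.
    apply/seteqP; split=> [_ [_ [w Ww <-] <-]|_ [_ [w Ww <-] <-]].
      by exists (sub_val w); [exists w | rewrite linearD].
    by exists (v + w); [exists w | rewrite linearD].
  have [G oG AG] : open (~` A) by rewrite openC.
  have -> : sub_val @` A = ~` G `&` Z.
    apply/seteqP; split=> [_ [x Ax <-]|x [Gx Zx]].
      split; last exact: subsp_valP.
      move=> Gx; have : (~` A) x by rewrite -AG.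
      exact.
    exists (exist _ x (mem_set Zx)) => //; apply: contrapT => nA.
    have : (~` A) (exist _ x (mem_set Zx)) by [].
    by rewrite -AG.
  by apply: closedI => //; rewrite closedC.
have fC' : finI C' id.
  move=> D' sD'.
  have pre (B : set V) : exists A, B \in D' -> C A /\ sub_val @` A = B.
    have [BD|nB] := boolP (B \in D'); last by exists set0.
    by have /set_mem[A CA AB] := sD' _ BD; exists A.
  pose g (B : set V) := sval (cid (pre B)).
  have gP (B : set V) : B \in D' -> C (g B) /\ sub_val @` g B = B.
    exact: (svalP (cid (pre B))).
  have [|x hx] := fC [fset g B | B in D']%fset.
    by move=> _ /imfsetP[B /= BD ->]; apply/mem_set; case: (gP B BD).
  exists (sub_val x) => B /= BD; case: (gP B BD) => _ <-.
  by exists x => //; apply: hx => /=; apply/imfsetP; exists B.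
have [x hx] := cV C' hC' fC'.
have [y0 _ y0x] : (sub_val @` A0) x by apply: hx; exists A0.
exists y0 => A CA; have [y Ay yx] : (sub_val @` A) x by apply: hx; exists A.
by have -> : y0 = y by apply: (@subsp_val_inj K V Z); rewrite /sub_val in y0x yx; rewrite y0x.
Qed.

Lemma quot_linearly_topologized :
  linearly_topologized V -> linearly_topologized (quot_topvect Z).
Proof.
move=> [hV bV]; split.
  rewrite open_hausdorff => p q.
  rewrite -(quotsp_reprK p) -(quotsp_reprK q).
  set v := quotsp_repr p; set w := quotsp_repr q => /eqP/quotsp_piE nvw.
  have oZ : open (~` (Z : set V)) by rewrite openC.
  have nZ : nbhs (v - w) (~` (Z : set V)) by apply: open_nbhs_nbhs; split.
  have [U [nU UZ]] := bV _ (nbhs_translate nZ).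
  have oU := subspace_nbhs_open nU.
  exists (quotsp_pi Z @` [set v + x | x in U], quotsp_pi Z @` [set w + x | x in U]).
    split; apply/mem_set; [exists v | exists w] => //; exists 0;
      rewrite ?addr0 //; exact: subspace0.
  split; [| |apply/eqP; apply/seteqP; split=> //].
  - by apply: quotsp_pi_open; exact: open_translate.
  - by apply: quotsp_pi_open; exact: open_translate.
  - move=> _ [[_ [x Ux <-] <-] [_ [y Uy <-] /quotsp_piE]].
    have [z nz ze] := UZ _ (subspaceB Ux Uy).
    move=> Zwv; apply: nz; have -> : z = - (w + y - (v + x)).
      by rewrite opprB opprD addrACA -ze addNKr.
    exact: subspaceN.
move=> A nA.
have nA' : nbhs (quot_pi Z 0 : quot_topvect Z) A by rewrite linear0.
have [U [nU UA]] := bV _ (@quotsp_pi_continuous K V Z 0 _ nA').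
have U0 : (quot_pi Z @` U) 0.
  by exists 0; [exact: subspace0 | rewrite linear0].
have UD a x y : (quot_pi Z @` U) x -> (quot_pi Z @` U) y -> (quot_pi Z @` U) (a *: x + y).
  move=> [u Uu <-] [t Ut <-]; exists (a *: u + t); last by rewrite linearP.
  by apply: subspaceD => //; exact: subspaceZ.
exists (mk_subspace U0 UD); split; last by move=> _ [u Uu <-]; exact: UA.
rewrite -[0](linear0 (quot_pi Z)); exact: (quotsp_pi_nbhs Z nU).
Qed.

Lemma quot_linearly_compact : linearly_compact V -> linearly_compact (quot_topvect Z).
Proof.
move=> [/quot_linearly_topologized tV cV]; split=> // C hC fC.
pose C' := [set quot_pi Z @^-1` A | A in C].
have surj (A : set (quot_topvect Z)) : quot_pi Z @` (quot_pi Z @^-1` A) = A.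
  apply/seteqP; split=> [_ [x Ax <-] //|q Aq].
  by exists (quotsp_repr q); rewrite /= /quot_pi quotsp_reprK.
have hC' B : C' B -> closed B /\ linear_variety B.
  move=> [A /hC[cA [q [W AE]]] <-]; split.
    by apply: (@closed_comp V (quot_topvect Z) (quot_pi Z)) => // x _;
      exact: quotsp_pi_continuous.
  exists (quotsp_repr q), (preim_subspace (quot_pi Z) W).
  rewrite AE; apply/seteqP; split=> [x /= [w Ww wx]|_ [w Ww <-]] /=.
    exists (x - quotsp_repr q); last by rewrite addrCA subrr addr0.
    suff e : quot_pi Z (x - quotsp_repr q) = w by move: Ww; rewrite -e.
    have qE : quot_pi Z (quotsp_repr q) = q by exact: quotsp_reprK.
    by rewrite linearB /= qE -wx addrAC subrr add0r.
  have qE : quot_pi Z (quotsp_repr q) = q by exact: quotsp_reprK.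
  by exists (quot_pi Z w) => //; rewrite linearD /= qE.
have fC' : finI C' id.
  move=> D' sD'.
  pose g (B : set V) : set (quot_topvect Z) := quot_pi Z @` B.
  have [|q hq] := fC [fset g B | B in D']%fset.
    move=> _ /imfsetP[B /= BD ->]; apply/mem_set.
    by have /set_mem[A CA <-] := sD' _ BD; rewrite /g surj.
  exists (quotsp_repr q) => B /= BD.
  have /set_mem[A CA AB] := sD' _ BD.
  have : (quot_pi Z @` B) q by apply: hq => /=; apply/imfsetP; exists B.
  by rewrite -AB surj /= /quot_pi quotsp_reprK.
have [x hx] := cV C' hC' fC'.
by exists (quot_pi Z x) => A CA; apply: (hx (quot_pi Z @^-1` A)); exists A.
Qed.

End LinearlyCompactTheory.

Record flow (K : fieldType) := Flow {
  flow_space :> topVect K;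
  flow_map : {linear flow_space -> flow_space};
  flow_linearly_compact : linearly_compact flow_space;
  flow_continuous : continuous flow_map
}.

Definition closed_invariant (K : fieldType) (F : flow K) (Z : lsubspace F) : Prop :=
  closed (Z : set F) /\ flow_map F @` Z `<=` Z.

Section Subflow.
Variables (K : fieldType) (F : flow K) (Z : lsubspace F).
Hypothesis hZ : closed_invariant Z.

Lemma subflow_map_subproof (x : sub_topvect Z) :
  flow_map F (sub_val x) \in (Z : set F).
Proof. by apply/mem_set; apply: hZ.2; exists (sub_val x) => //; exact: subsp_valP. Qed.

Definition subflow_map (x : sub_topvect Z) : sub_topvect Z :=
  exist _ (flow_map F (sub_val x)) (subflow_map_subproof x).

Lemma subflow_map_linear : linear subflow_map.
Proof.
move=> a x y; apply: (@subsp_val_inj K F Z).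
by rewrite /subflow_map -[LHS]/(flow_map F (sub_val (a *: x + y))) !linearP.
Qed.

HB.instance Definition _ := GRing.isLinear.Build K (sub_topvect Z)
  (sub_topvect Z) _ subflow_map subflow_map_linear.

Lemma subflow_map_continuous : continuous subflow_map.
Proof.
apply: (@subsp_continuous K F Z) => x.
apply: (@continuous_comp _ _ _ (@sub_val K F Z) (flow_map F)).
  exact: subsp_val_continuous.
exact: flow_continuous.
Qed.

Definition subflow : flow K := @Flow K (sub_topvect Z) subflow_map
  (sub_linearly_compact hZ.1 (flow_linearly_compact F)) subflow_map_continuous.

Definition quotflow_map (q : quot_topvect Z) : quot_topvect Z :=
  quot_pi Z (flow_map F (quotsp_repr q)).

Lemma quotflow_map_pi x : quotflow_map (quot_pi Z x) = quot_pi Z (flow_map F x).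
Proof.
apply/quotsp_piE; rewrite -linearB; apply: hZ.2; exists (quotsp_repr (quot_pi Z x) - x) => //.
by apply/quotsp_piE; rewrite quotsp_reprK.
Qed.

Lemma quotflow_map_linear : linear quotflow_map.
Proof.
move=> a p q; rewrite -(quotsp_reprK p) -(quotsp_reprK q).
by rewrite -!/(quot_pi Z _) -linearP !quotflow_map_pi !linearP.
Qed.

HB.instance Definition _ := GRing.isLinear.Build K (quot_topvect Z)
  (quot_topvect Z) _ quotflow_map quotflow_map_linear.

Lemma quotflow_map_continuous : continuous quotflow_map.
Proof.
apply/quotient_continuous => x.
have -> : quotflow_map \o \pi_{ideal_quot (subspace_pred Z)} = quot_pi Z \o flow_map F.
  by apply/funext => v; exact: quotflow_map_pi.
apply: continuous_comp; first exact: flow_continuous.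
exact: quotsp_pi_continuous.
Qed.

Definition quotflow : flow K := @Flow K (quot_topvect Z) quotflow_map
  (quot_linearly_compact hZ.1 (flow_linearly_compact F)) quotflow_map_continuous.

End Subflow.

Section Entropy.
Variables (R : realType) (K : fieldType).

(* The dimension in N u {oo}: [Vector.axiom n E] says that [E] is linearly
   isomorphic to K^n, which holds for at most one [n]; the infimum of the empty
   set is [+oo]. *)
Definition dimension (E : lmodType K) : \bar R :=
  ereal_inf [set n%:R%:E | n in [set n : nat | $|Vector.axiom n E| ]].

(* The intersection of the preimages of U under the first n iterates, that is
   U `&` phi^-1 U `&` ... `&` phi^-(n-1) U when 0 < n. *)
Definition cotrajectory (F : flow K) (U : lsubspace F) (n : nat) : lsubspace F :=
  cap_subspace (fun i => iter i (preim_subspace (flow_map F)) U) n.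

(* U / (U `&` phi^-1 U `&` ... `&` phi^-(n-1) U). *)
Definition cotrajectory_quotient (F : flow K) (U : lsubspace F) (n : nat) :
    topVect K :=
  quot_topvect (preim_subspace (@sub_val K F U) (cotrajectory U n)).

Definition ent_star (F : flow K) : \bar R :=
  ereal_sup
    [set limn (fun n => (n%:R^-1)%:E * dimension (cotrajectory_quotient U n))%E
    | U in [set U : lsubspace F |
             open (U : set F) /\ linearly_compact (sub_topvect U)]].

Definition completely_positive_entropy (F : flow K) : Prop :=
  forall (Z : lsubspace F) (hZ : closed_invariant Z),
    (Z : set F) <> setT -> ent_star (quotflow hZ) <> 0%E.

Definition largest_cpe (F : flow K) (D : lsubspace F) : Prop :=
  (exists hD : closed_invariant D, completely_positive_entropy (subflow hD)) /\
  forall (Z : lsubspace F) (hZ : closed_invariant Z),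
    completely_positive_entropy (subflow hZ) -> (Z : set F) `<=` D.

(* The largest such subspace always exists, so the default value of [xget] is
   never used. *)
Definition D_plus (F : flow K) : lsubspace F :=
  xget (full_subspace F) [set D : lsubspace F | largest_cpe D].

Lemma D_plus_closed_invariant (F : flow K) : closed_invariant (D_plus F).
Proof.
by rewrite /D_plus; case: xgetP => [D _ [[hD _] _] //|_]; split=> //; exact: closedT.
Qed.

Definition Lambda (F : flow K) : set (lsubspace F) :=
  [set N | closed_invariant N].

Definition coindependent_finite (F : flow K) (S : set (lsubspace F)) : Prop :=
  [/\ finite_set S,
      forall N, S N -> Lambda N /\ (N : set F) <> setT &
      forall N, S N ->
        [set x + y | x in (N : set F) & y in
          \bigcap_(M in S `\ N) (M : set F)] = setT].

Definition coindependent (F : flow K) (C : set (lsubspace F)) : Prop :=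
  forall S, S `<=` C -> finite_set S -> coindependent_finite S.

(* Without an infinite coindependent set the cardinalities below are bounded,
   so that their supremum is the maximal cardinality. *)
Definition dual_goldie_dim (F : flow K) : \bar R :=
  if `[< exists C : set (lsubspace F), infinite_set C /\ coindependent C >]
  then +oo%E
  else ereal_sup [set n%:R%:E | n in
    [set n : nat | exists2 C : set (lsubspace F),
      (C #= `I_n)%card & coindependent_finite C]].

Definition cork (F : flow K) : \bar R :=
  dual_goldie_dim (subflow (D_plus_closed_invariant F)).

End Entropy.

(* Main.v *)
(* By Lefschetz duality V is encoded by the K[X]-module M of its continuous
   linear functionals, with X f = f o phi, and both sides of the identity equal
   the rank of M.

   Entropy: an open subspace U is the common kernel of finitely many functionals
   f_i.  If S indexes a maximal K[X]-independent subfamily, the dimension of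
   U / (U `&` phi^-1 U `&` ... `&` phi^-(n-1) U) differs from n * #|S| by a
   bounded amount.

   Corank: the largest subspace with completely positive entropy is the
   annihilator D of the torsion submodule of M.  The module of D is M modulo its
   torsion; it is torsion-free of the same rank.  Over a torsion-free module,
   independent functionals f_i yield the coindependent subspaces
   {v | f_i (phi^k v) = 0 for all k}; conversely nonzero functionals vanishing on
   the members of a coindependent family are K[X]-independent.

   Linear compactness enters by way of one fact: a system of equations g v = c,
   with continuous functionals g, is solvable as soon as all its finite
   subsystems are. *)
Require Import Defs.
From HB Require Import structures.
From mathcomp Require Import all_boot all_order all_algebra.
From mathcomp Require Import finmap.
From mathcomp Require Import all_classical all_reals all_analysis.

Set Implicit Arguments.
Unset Strict Implicit.
Unset Printing Implicit Defensive.

Import Order.TTheory GRing.Theory Num.Theory numFieldNormedType.Exports.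
Local Open Scope classical_set_scope.
Local Open Scope ring_scope.

(** * Finite families of linear functionals *)

Section Functionals.
Variables (K : fieldType) (E : lmodType K).
Implicit Types (f : E -> K) (U : lsubspace E).

Lemma scalar_fun0 f : scalar f -> f 0 = 0.
Proof. by move=> sf; have := sf (-1) 0 0; rewrite scaler0 addr0 mulN1r addNr. Qed.

Lemma scalar_funD f x y : scalar f -> f (x + y) = f x + f y.
Proof. by move=> sf; have := sf 1 x y; rewrite scale1r mul1r. Qed.

Lemma scalar_funZ f a x : scalar f -> f (a *: x) = a * f x.
Proof. by move=> sf; have := sf a x 0; rewrite addr0 (scalar_fun0 sf) addr0. Qed.

Lemma scalar_funB f x y : scalar f -> f (x - y) = f x - f y.
Proof. by move=> sf; rewrite scalar_funD// -scaleN1r scalar_funZ// mulN1r. Qed.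

Lemma scalar_fun_sum f (I : Type) (r : seq I) (P : pred I) (F : I -> E) :
  scalar f -> f (\sum_(i <- r | P i) F i) = \sum_(i <- r | P i) f (F i).
Proof.
move=> sf; elim/big_rec2: _ => [|i x y _ <-]; first exact: scalar_fun0.
exact: scalar_funD.
Qed.

Lemma subspace_sum U (I : Type) (r : seq I) (P : pred I) (F : I -> E) :
  (forall i, P i -> (U : set E) (F i)) -> (U : set E) (\sum_(i <- r | P i) F i).
Proof.
move=> UF; elim/big_rec: _ => [|i x Pi Ux]; first exact: subspace0.
by apply: subspaceD => //; exact: UF.
Qed.

(** For linear [h] this is linear independence of the [h i], [i \in J], on [U]. Stated as
    surjectivity of evaluation, it yields dual vectors and solutions of finite systems directly. *)
Definition onto_on U (I : finType) (J : {set I}) (h : I -> E -> K) : Prop :=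
  forall c : I -> K, exists v, (U : set E) v /\ forall i, i \in J -> h i v = c i.

Section Onto.
Variables (U : lsubspace E) (I : finType) (h : I -> E -> K).
Hypothesis sh : forall i, scalar (h i).

Lemma onto_on_dual (J : {set I}) : onto_on U J h ->
  exists e : I -> E, forall i, (U : set E) (e i) /\
    forall j, j \in J -> h j (e i) = (j == i)%:R.
Proof. by move=> oJ; have [e he] := choice (fun i => oJ (fun j => (j == i)%:R)); exists e. Qed.

(** A largest [J] works: a vector killed by [J] but not by some [h i] could be rescaled to adjust
    the value of [h i] alone, so [i |: J] would still be onto. *)
Lemma max_onto_on (J0 : {set I}) : exists J : {set I},
  [/\ J \subset J0, onto_on U J h &
   forall v, (U : set E) v -> (forall i, i \in J -> h i v = 0) ->
     forall i, i \in J0 -> h i v = 0].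
Proof.
pose P := fun J : {set I} => (J \subset J0) && `[< onto_on U J h >].
have P0 : P finset.set0.
  rewrite /P finset.sub0set; apply/asboolP => c.
  by exists 0; split; [exact: subspace0|move=> i; rewrite finset.in_set0].
have [J /maxsetP[/andP[JJ0 /asboolP oJ] maxJ] _] := maxset_exists P0.
exists J; split=> // v Uv hv i iJ0; apply: contrapT => /eqP hiv.
have iJ : i \notin J by apply: contra hiv => /hv ->.
have : i |: J = J; last by move/setP/(_ i); rewrite !inE eqxx (negbTE iJ).
apply: maxJ; last exact: finset.subsetUr.
rewrite /P finset.subUset finset.sub1set iJ0 JJ0 /=.
apply/asboolP => c; have [w [Uw hw]] := oJ c.
exists (((c i - h i w) / h i v) *: v + w); split.
  by apply: subspaceD => //; exact: subspaceZ.
move=> j; rewrite !inE => /orP[/eqP ->|jJ].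
  by rewrite sh divfK// subrK.
by rewrite sh (hv _ jJ) mulr0 add0r hw.
Qed.

(** Subtracting from [v] its expansion along dual vectors [e i] leaves a vector killed by all of
    [J], hence by [f]; the coefficients are [f (e i)]. *)
Lemma onto_on_span (J : {set I}) f : onto_on U J h -> scalar f ->
  (forall v, (U : set E) v -> (forall i, i \in J -> h i v = 0) -> f v = 0) ->
  exists c : I -> K, forall v, (U : set E) v -> f v = \sum_(i in J) c i * h i v.
Proof.
move=> /onto_on_dual[e he] sf fJ; exists (fun i => f (e i)) => v Uv.
apply/eqP; rewrite -subr_eq0; apply/eqP.
transitivity (f (v - \sum_(i in J) h i v *: e i)).
  rewrite scalar_funB// scalar_fun_sum//; congr (_ - _).
  by apply: eq_bigr => i _; rewrite scalar_funZ// mulrC.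
apply: fJ.
  apply: subspaceB => //; apply: subspace_sum => i _.
  by apply: subspaceZ; exact: (he i).1.
move=> j jJ; rewrite scalar_funB// scalar_fun_sum// (bigD1 j)//= scalar_funZ//.
rewrite (he j).2// eqxx mulr1 big1 ?addr0 ?subrr// => i /andP[iJ ij].
by rewrite scalar_funZ// (he i).2// eq_sym (negbTE ij) mulr0.
Qed.

(** An index of [J0] outside a maximal onto [J] would be a combination of [J], that is, a nontrivial
    relation. *)
Lemma indep_onto_on (J0 : {set I}) :
  (forall c : I -> K,
    (forall v, (U : set E) v -> \sum_(i in J0) c i * h i v = 0) ->
    forall i, i \in J0 -> c i = 0) ->
  onto_on U J0 h.
Proof.
move=> indep; have [J [JJ0 oJ kJ]] := max_onto_on J0.
suff <- : J = J0 by [].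
apply/eqP; rewrite finset.eqEsubset JJ0; apply/fintype.subsetP => i iJ0.
apply: contrapT => /negP iJ.
have [v Uv hv|c hc] := @onto_on_span J (h i) oJ (sh i); first exact: kJ.
suff : ((i == i)%:R - (i \in J)%:R * c i : K) = 0.
  by rewrite eqxx (negbTE iJ) mul0r subr0 => /eqP; rewrite oner_eq0.
apply: (indep (fun j => (j == i)%:R - (j \in J)%:R * c j)) => // v Uv.
under eq_bigr do rewrite mulrBl.
rewrite sumrB (bigD1 i)//= eqxx mul1r big1 ?addr0; last first.
  by move=> j /andP[_ /negbTE ->]; rewrite mul0r.
rewrite hc// big_mkcond [X in _ - X]big_mkcond/= -sumrB big1// => j _.
have [jJ|jJ] := boolP (j \in J); last by rewrite !mul0r if_same subrr.
by rewrite (fintype.subsetP JJ0)// mul1r subrr.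
Qed.

(** With fewer functionals in [g] than indices in [J], the matrix of [g] on the dual vectors has a
    nonzero left kernel vector. It gives a combination of dual vectors killed by [g] on which some
    [h i] is nonzero. *)
Lemma onto_on_card (J : {set I}) (g : seq (E -> K)) : onto_on U J h ->
  (forall x, x \in g -> scalar x) ->
  (forall v, (U : set E) v -> (forall x, x \in g -> x v = 0) ->
     forall i, i \in J -> h i v = 0) ->
  (#|J| <= size g)%N.
Proof.
move=> /onto_on_dual[e he] sg kg; rewrite leqNgt; apply/negP => ltg.
pose A := \matrix_(i < #|J|, j < size g) (nth (fun=> 0) g j) (e (enum_val i)).
have rA : (\rank A < #|J|)%N by apply: leq_ltn_trans ltg; exact: rank_leq_col.
have : kermx A != 0 by rewrite -mxrank_eq0 mxrank_ker subn_eq0 -ltnNge.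
case/rowV0Pn => x /sub_kermxP xA /eqP; apply; apply/rowP => i; rewrite mxE.
pose v := \sum_k x 0 k *: e (enum_val k).
have <- : h (enum_val i) v = x 0 i.
  rewrite scalar_fun_sum// (bigD1 i)//= scalar_funZ// (he _).2 ?enum_valP//.
  rewrite eqxx mulr1 big1 ?addr0// => k ki.
  rewrite scalar_funZ// (he _).2 ?enum_valP// (inj_eq enum_val_inj).
  by rewrite eq_sym (negbTE ki) mulr0.
apply: kg; last exact: enum_valP.
  by apply: subspace_sum => k _; apply: subspaceZ; exact: (he _).1.
move=> y yg; have sy := sg _ yg; rewrite scalar_fun_sum//.
have yi : (index y g < size g)%N by rewrite index_mem.
have := congr1 (fun M : 'rV_(size g) => M 0 (Ordinal yi)) xA; rewrite !mxE => xA0.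
rewrite -[RHS]xA0; apply: eq_bigr => k _; rewrite scalar_funZ// mxE /=.
by rewrite nth_index.
Qed.

End Onto.
End Functionals.

(** * Continuous functionals on linearly compact spaces *)

(** Zorn's lemma gives a subspace [U] maximal among those that contain [W] and avoid [v]. It is a
    complement of the line through [v], and [f] is the coordinate along [v]. *)
Lemma hyperplane_separation (K : fieldType) (E : lmodType K) (W : lsubspace E) (v : E) :
  ~ (W : set E) v ->
  exists f : E -> K, [/\ scalar f, forall w, (W : set E) w -> f w = 0 & f v = 1].
Proof.
move=> Wv.
pose P (X : set E) := exists U : lsubspace E, X = U /\ (W : set E) `<=` U /\ ~ (U : set E) v.
(* The union with [W] handles the empty chain, whose union is the empty set and not a subspace. *)
pose Q (X : set E) := P (X `|` W).
have [F FQ Ftot|M [[U [MU [WU Uv]]] maxM]] := @Zorn_bigcup E Q.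
  have [->|/set0P[X0 FX0]] := eqVneq F set0.
    by rewrite /Q bigcup_set0 set0U; exists W; split=> //; split.
  have UF x : (\bigcup_(X in F) X `|` W) x <-> exists2 X, F X & (X `|` W) x.
    split=> [[[X FX Xx]|Wx]|[X FX [Xx|Wx]]]; try by [right].
    - by exists X => //; left.
    - by exists X0 => //; right.
    - by left; exists X.
  have U0 : (\bigcup_(X in F) X `|` W) 0 by right; exact: subspace0.
  have UD a x y : (\bigcup_(X in F) X `|` W) x -> (\bigcup_(X in F) X `|` W) y ->
      (\bigcup_(X in F) X `|` W) (a *: x + y).
    move=> /UF[X FX Xx] /UF[Y FY Yy]; apply/UF.
    wlog [Z FZ [Zx Zy]] : / exists2 Z, F Z & (Z `|` W) x /\ (Z `|` W) y.
      apply; have [XY|YX] := Ftot _ _ FX FY.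
        by exists Y => //; split=> //; apply: setSU Xx.
      by exists X => //; split=> //; apply: setSU Yy.
    exists Z => //; have [U [ZU _]] := FQ _ FZ.
    by move: Zx Zy; rewrite ZU => Zx Zy; apply: subspaceD => //; exact: subspaceZ.
  exists (mk_subspace U0 UD); split=> //; split; first by right.
  by move=> /UF[X /FQ[U [-> [_ Uv]]]].
(* Otherwise the span of [U] and [x], which is [A] below, would still avoid [v]. *)
have maxU x : ~ (U : set E) x -> exists a, (U : set E) (v - a *: x).
  move=> Ux; apply: contrapT => nex.
  pose A := [set y | exists a, (U : set E) (y - a *: x)].
  have A0 : A 0 by exists 0; rewrite scale0r subr0; exact: subspace0.
  have AD b y z : A y -> A z -> A (b *: y + z).
    move=> [c Uy] [d Uz]; exists (b * c + d).
    rewrite scalerDl -scalerA opprD addrACA -scalerBr.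
    by apply: subspaceD => //; exact: subspaceZ.
  have UA : (U : set E) `<=` A by move=> y Uy; exists 0; rewrite scale0r subr0.
  have AW : A `|` W = A by apply/setUidPl => w /WU; exact: UA.
  apply: (maxM A); last first.
    exists (mk_subspace A0 AD); split; first exact: AW.
    by split=> [w /WU /UA|[a ?]] //; apply: nex; exists a.
  split; first by apply: subset_trans UA; rewrite -MU; exact: subsetUl.
  move=> AM; apply: Ux; rewrite -MU; left; apply: AM; exists 1.
  by rewrite scale1r subrr; exact: subspace0.
have decomp x : exists a, (U : set E) (x - a *: v).
  have [Ux|/maxU[a Ua]] := pselect ((U : set E) x).
    by exists 0; rewrite scale0r subr0.
  have a0 : a != 0.
    by apply/eqP => a0; apply: Uv; move: Ua; rewrite a0 scale0r subr0.
  exists a^-1; rewrite -[x](scalerK a0) -scalerBr -opprB scalerN.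
  by apply: subspaceN; exact: subspaceZ.
have uniq x a b : (U : set E) (x - a *: v) -> (U : set E) (x - b *: v) -> a = b.
  move=> Ua Ub; apply: contrapT => /eqP; rewrite -subr_eq0 => ab; apply: Uv.
  rewrite -[v](scalerK ab); apply: subspaceZ.
  suff -> : (a - b) *: v = (x - b *: v) - (x - a *: v) by exact: subspaceB.
  by rewrite opprB [a *: v - x]addrC addrACA subrr add0r scalerBl addrC.
have [f hf] := choice decomp.
exists f; split.
- move=> a x y; apply: (uniq (a *: x + y)); first exact: hf.
  rewrite scalerDl -scalerA opprD addrACA -scalerBr.
  by apply: subspaceD; [apply: subspaceZ|]; exact: hf.
- move=> w /WU Uw; apply: (uniq w); first exact: hf.
  by rewrite scale0r subr0.
- apply: (uniq v); first exact: hf.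
  by rewrite scale1r subrr; exact: subspace0.
Qed.

Section ContinuousFunctionals.
Variables (K : fieldType) (V : topVect K).
Implicit Types (f g : V -> K) (U Z : lsubspace V).

(** Continuity of a linear functional into discrete [K]: an open kernel makes every preimage open,
    by [cfun_open_preimage]. *)
Definition cfun f : Prop := scalar f /\ open [set v | f v = 0].

Lemma open_supspace U Z : open (U : set V) -> (U : set V) `<=` Z -> open (Z : set V).
Proof.
move=> oU UZ; apply: subspace_nbhs_open; apply: filterS UZ _.
by apply: open_nbhs_nbhs; split => //; exact: subspace0.
Qed.

Lemma ker_subproof f : scalar f ->
  forall a x y, f x = 0 -> f y = 0 -> f (a *: x + y) = 0.
Proof. by move=> sf a x y fx fy; rewrite sf fx fy mulr0 addr0. Qed.

Definition ker_subspace f (sf : scalar f) : lsubspace V :=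
  @mk_subspace K V [set v | f v = 0] (scalar_fun0 sf) (ker_subproof sf).

Lemma cfun_supspace U f : open (U : set V) -> scalar f ->
  (forall u, (U : set V) u -> f u = 0) -> cfun f.
Proof. by move=> oU sf Uf; split=> //; exact: (@open_supspace U (ker_subspace sf)). Qed.

Lemma cfun0 : cfun (fun=> 0).
Proof.
split; first by move=> a x y; rewrite mulr0 addr0.
have -> : [set _ | 0 = 0 :> K] = [set: V] by apply/seteqP; split.
exact: openT.
Qed.

Lemma cfun_comb a f g : cfun f -> cfun g -> cfun (fun v => a * f v + g v).
Proof.
move=> [sf of_] [sg og].
have s : scalar (fun v => a * f v + g v).
  by move=> b x y; rewrite sf sg !mulrDr addrACA !mulrA [a * b]mulrC.
split=> //; apply: (@subspace_nbhs_open _ _ (ker_subspace s)).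
rewrite nbhsE; exists ([set v | f v = 0] `&` [set v | g v = 0]); last first.
  by move=> v [/= -> ->]; rewrite mulr0 addr0.
by split; [exact: openI|split; exact: scalar_fun0].
Qed.

Lemma cfun_sum (I : Type) (r : seq I) (P : pred I) (c : I -> K) (h : I -> V -> K) :
  (forall i, P i -> cfun (h i)) -> cfun (fun v => \sum_(i <- r | P i) c i * h i v).
Proof.
move=> ch; elim: r => [|i r IH].
  by under eq_fun do rewrite big_nil; exact: cfun0.
under eq_fun do rewrite big_cons.
by have [Pi|//] := boolP (P i); apply: cfun_comb => //; exact: ch.
Qed.

Lemma cfun_open_preimage f (B : set K) : cfun f -> open (f @^-1` B).
Proof.
move=> [sf of_].
have -> : f @^-1` B = \bigcup_(v in f @^-1` B) [set v + u | u in [set u | f u = 0]].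
  apply/seteqP; split=> [v Bv|_ [v Bv [u /= fu <-]]].
    by exists v => //; exists 0; rewrite ?addr0 //=; exact: scalar_fun0.
  by rewrite /preimage /= scalar_funD// fu addr0.
by apply: bigcup_open => v _; exact: open_translate.
Qed.

Lemma cfun_closed_preimage f (B : set K) : cfun f -> closed (f @^-1` B).
Proof.
move=> cf; rewrite -[X in closed X]setCK closedC.
exact: (@cfun_open_preimage _ (~` B)).
Qed.

Lemma open_subspace_closed U : open (U : set V) -> closed (U : set V).
Proof.
move=> oU; rewrite -[X in closed X]setCK closedC.
have -> : ~` (U : set V) = \bigcup_(v in ~` (U : set V)) [set v + u | u in U].
  apply/seteqP; split=> [v Uv|_ [v Uv [u Uu <-]] /= Uvu].
    by exists v => //; exists 0; rewrite ?addr0 //; exact: subspace0.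
  by apply: Uv; rewrite -(addrK u v); exact: subspaceB.
by apply: bigcup_open => v _; exact: open_translate.
Qed.

(** As [Z] is closed, some open subspace [U] has [v] outside [Z + U]. Separate [v] from [Z + U]
    algebraically; vanishing on the open [U] makes the functional continuous. *)
Lemma closed_separation Z v : linearly_topologized V -> closed (Z : set V) ->
  ~ (Z : set V) v ->
  exists f, [/\ cfun f, forall z, (Z : set V) z -> f z = 0 & f v = 1].
Proof.
move=> [_ bV] cZ Zv.
have nZ : nbhs v (~` (Z : set V)).
  by apply: open_nbhs_nbhs; split=> //; rewrite openC.
have [U [nU UZ]] := bV _ (nbhs_translate nZ).
have oU := subspace_nbhs_open nU.
pose A := [set x | exists2 u, (U : set V) u & (Z : set V) (x - u)].
have A0 : A 0 by exists 0; rewrite ?subr0; exact: subspace0.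
have AD a x y : A x -> A y -> A (a *: x + y).
  move=> [u Uu Zx] [w Uw Zy]; exists (a *: u + w).
    by apply: subspaceD => //; exact: subspaceZ.
  rewrite opprD addrACA -scalerBr.
  by apply: subspaceD => //; exact: subspaceZ.
have [|f [sf Af fv]] := @hyperplane_separation K V (mk_subspace A0 AD) v.
  move=> [u Uu Zvu]; have [z nZz] := UZ _ (subspaceN Uu).
  by move=> ze; apply: nZz; rewrite -[z](addNKr v) ze.
exists f; split=> //.
  apply: (cfun_supspace oU sf) => u Uu; apply: Af; exists u => //.
  by rewrite subrr; exact: subspace0.
by move=> z Zz; apply: Af; exists 0; rewrite ?subr0 //; exact: subspace0.
Qed.

Section Compactness.
Hypothesis lcV : linearly_compact V.

(** The solution set of one equation is a translate of a kernel, hence a closed linear variety;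
    solvability of finite subsystems is the finite intersection property. *)
Lemma compact_solve (S : set ((V -> K) * K)) :
  (forall x, S x -> cfun x.1) ->
  (forall s : seq ((V -> K) * K), (forall x, x \in s -> S x) ->
     exists v, forall x, x \in s -> x.1 v = x.2) ->
  exists v, forall x, S x -> x.1 v = x.2.
Proof.
move=> cS fS.
pose sol (x : (V -> K) * K) := [set v | x.1 v = x.2].
have [| |v hv] := lcV.2 [set sol x | x in S].
- move=> _ [x Sx <-]; have cx := cS _ Sx; split.
    exact: (@cfun_closed_preimage x.1 [set x.2]).
  have [|v hv] := fS [:: x]; first by move=> y; rewrite inE => /eqP ->.
  have {}hv := hv x (mem_head _ _).
  exists v, (ker_subspace cx.1); apply/seteqP; split=> [w /= hw|_ [w /= hw <-]].
    exists (w - v) => /=; last by rewrite addrCA subrr addr0.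
    by rewrite scalar_funB ?hv ?hw ?subrr//; exact: cx.1.
  by rewrite /sol /= scalar_funD ?hw ?hv ?addr0//; exact: cx.1.
- move=> D hD.
  have pre (B : set V) : exists x, B \in D -> S x /\ sol x = B.
    have [BD|nB] := boolP (B \in D); last by exists (fun=> 0, 0).
    by have /set_mem[x Sx xB] := hD _ BD; exists x.
  have [g gP] := choice pre.
  have [|v hv] := fS [seq g B | B <- D].
    by move=> _ /mapP[B BD ->]; case: (gP B BD).
  exists v => B /= BD; case: (gP B BD) => _ <-.
  by apply: (hv (g B)); exact: map_f.
- by exists v => x Sx; apply: (hv (sol x)); exists x.
Qed.

(* Double annihilator theorem: if finitely many kernels from N never suffice
   to force f v = 0, the equations g v = 0, for g in N, and f v = 1 are finitely
   solvable, hence solvable. *)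
Lemma compact_span (N : set (V -> K)) f :
  N (fun=> 0) -> (forall a g h, N g -> N h -> N (fun v => a * g v + h v)) ->
  (forall g, N g -> cfun g) -> cfun f ->
  (forall v, (forall g, N g -> g v = 0) -> f v = 0) -> N f.
Proof.
move=> N0 ND cN cf kf; apply: contrapT => Nf.
have [| |v hv] := @compact_solve ([set x | N x.1 /\ x.2 = 0] `|` [set (f, 1)]).
- by move=> x [[/cN ? _]|->].
- move=> s hs.
  pose t := [seq x <- s | x != (f, 1)].
  pose h (i : 'I_(size t)) := (nth (f, 1) t i).1.
  have hN i : N (h i) /\ (nth (f, 1) t i).2 = 0.
    have : nth (f, 1) t i \in t by exact: mem_nth.
    rewrite mem_filter => /andP[/eqP nf /hs[//|e]].
    by exfalso; apply: nf; exact: e.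
  have sh i : scalar (h i) by exact: (cN _ (hN i).1).1.
  (* If the subsystem had no solution, [f] would vanish wherever all [h i] do: a vector violating
     this could be rescaled to a solution. Then [f] is a combination of the [h i] and lies in
     [N]. *)
  apply: contrapT => nex; apply: Nf.
  have [J [_ oJ kJ]] := max_onto_on (full_subspace V) sh finset.setT.
  have [|c hc] := onto_on_span sh oJ cf.1.
    move=> v _ hv; apply: contrapT => /eqP fv0; apply: nex.
    exists ((f v)^-1 *: v) => x xs.
    have [->|xf] := eqVneq x (f, 1) => /=.
      by rewrite scalar_funZ ?mulVf//; exact: cf.1.
    have xt : x \in t by rewrite mem_filter xf.
    have it : (index x t < size t)%N by rewrite index_mem.
    have e : nth (f, 1) t (Ordinal it) = x by exact: nth_index.
    have := (hN (Ordinal it)).2; rewrite e => ->.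
    rewrite -e -/(h _) scalar_funZ; last exact: sh.
    by rewrite (kJ v I hv) ?inE// mulr0.
  have -> : f = fun v => \sum_(i in J) c i * h i v by apply/funext => v; exact: hc.
  elim: (index_enum _) => [|i r IH]; first by under eq_fun do rewrite big_nil.
  under eq_fun do rewrite big_cons.
  by case: (i \in J) => //; apply: ND => //; exact: (hN i).1.
- have := kf v; have /= -> := hv (f, 1) (or_intror erefl) => f0.
  have /eqP := f0 (fun g Ng => hv (g, 0) (or_introl (conj Ng erefl))).
  by rewrite oner_eq0.
Qed.

End Compactness.
End ContinuousFunctionals.

Lemma cfun_comp (K : fieldType) (V W : topVect K) (T : {linear V -> W}) (f : W -> K) :
  continuous T -> cfun f -> cfun (f \o T).
Proof.
move=> cT [sf of_]; split; first by move=> a x y /=; rewrite linearP sf.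
by have /continuousP/(_ _ of_) := cT.
Qed.

Lemma sub_val_surj (K : fieldType) (V : topVect K) (Z : lsubspace V) (v : V) :
  (Z : set V) v -> exists w : sub_topvect Z, sub_val w = v.
Proof. by move=> Zv; exists (exist (fun x => x \in (Z : set V)) v (mem_set Zv)). Qed.

(* If no finite family of kernels cut out U, Gram-Schmidt yields an infinite
   biorthogonal family (x_n, e_n) with x_n = 0 on U.  On the open subspace of
   the v killed by almost all x_n, any finitely many of the equations x_n v = 1
   are solvable, and all of them together are not. *)
Lemma open_subspace_kernels (K : fieldType) (V : topVect K) (U : lsubspace V) :
  linearly_compact V -> open (U : set V) ->
  exists (m : nat) (h : 'I_m -> V -> K), (forall i, cfun (h i)) /\
    forall v, (U : set V) v <-> forall i, h i v = 0.
Proof.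
move=> lcV oU; apply: contrapT => nex.
pose d : (V -> K) * V := (fun=> 0, 0).
pose good (L : seq ((V -> K) * V)) := forall i, (i < size L)%N ->
  [/\ cfun (nth d L i).1, forall u, (U : set V) u -> (nth d L i).1 u = 0 &
      forall j, (j < size L)%N -> (nth d L i).1 (nth d L j).2 = (i == j)%:R].
have step (L : seq ((V -> K) * V)) : exists x : (V -> K) * V, good L -> good (rcons L x).
  have [gL|ngL] := pselect (good L); last by exists d.
  (* Otherwise the functionals of [L] already cut out [U]. *)
  have [v [Uv hv]] : exists v, ~ (U : set V) v /\
      forall i, (i < size L)%N -> (nth d L i).1 v = 0.
    apply: contrapT => nv; apply: nex.
    exists (size L), (fun i => (nth d L i).1); split=> [i|v].
      by case: (gL i (ltn_ord i)).
    split=> [Uv i|hv]; first by case: (gL i (ltn_ord i)) => _ + _; exact.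
    apply: contrapT => Uv; apply: nv; exists v; split=> // i iL.
    exact: (hv (Ordinal iL)).
  have [g [cg gU gv]] := closed_separation lcV.1 (open_subspace_closed oU) Uv.
  (* Gram-Schmidt correction: [f] kills the earlier vectors and still takes the value 1 at [v],
     which the earlier functionals kill. *)
  pose f w := (-1) * (\sum_(i < size L) g (nth d L i).2 * (nth d L i).1 w) + g w.
  have cf : cfun f.
    by apply: cfun_comb => //; apply: cfun_sum => i _; case: (gL i (ltn_ord i)).
  have fU u : (U : set V) u -> f u = 0.
    move=> Uu; rewrite /f gU// big1 ?mulr0 ?addr0// => i _.
    by case: (gL i (ltn_ord i)) => _ -> //; rewrite mulr0.
  have fv : f v = 1.
    by rewrite /f gv big1 ?mulr0 ?add0r// => i _; rewrite hv ?mulr0.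
  have fL j : (j < size L)%N -> f (nth d L j).2 = 0.
    move=> jL; rewrite /f (bigD1 (Ordinal jL))//=.
    case: (gL j jL) => _ _ ->//; rewrite eqxx mulr1 big1 ?addr0 ?mulN1r ?addNr//.
    move=> i ij; case: (gL i (ltn_ord i)) => _ _ ->//.
    by move: ij; rewrite -val_eqE /= => /negbTE ->; rewrite mulr0.
  exists (f, v) => _ i; rewrite size_rcons ltnS => iL.
  rewrite nth_rcons; move: iL; rewrite leq_eqVlt => /orP[/eqP ->|iL].
    rewrite ltnn eqxx; split=> // j; rewrite ltnS leq_eqVlt nth_rcons.
    move=> /orP[/eqP ->|jL]; first by rewrite ltnn eqxx.
    by rewrite jL /= fL// gtn_eqF.
  rewrite iL; have [ci iU iL'] := gL i iL; split=> // j.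
  rewrite ltnS leq_eqVlt nth_rcons => /orP[/eqP ->|jL].
    by rewrite ltnn eqxx /= hv// ltn_eqF.
  by rewrite jL iL'.
have [g hg] := choice step.
pose L n := iter n (fun s => rcons s (g s)) [::].
have sL n : size (L n) = n by elim: n => //= n IH; rewrite size_rcons IH.
have gL n : good (L n) by elim: n => [i //|n]; exact: hg.
pose x n := g (L n).
have nL n m : (m < n)%N -> nth d (L n) m = x m.
  elim: n => // n IH; rewrite ltnS leq_eqVlt /= nth_rcons sL.
  by move=> /orP[/eqP ->|mn]; [rewrite ltnn eqxx|rewrite mn IH].
have cx n : cfun (x n).1.
  by have := gL n.+1 n; rewrite sL nL// => /(_ (ltnSn n))[].
have xU n u : (U : set V) u -> (x n).1 u = 0.
  by have := gL n.+1 n; rewrite sL nL// => /(_ (ltnSn n))[_ + _]; exact.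
have xe n m : (x n).1 (x m).2 = (n == m)%:R.
  have nN : (n < (maxn n m).+1)%N by rewrite ltnS leq_maxl.
  have mN : (m < (maxn n m).+1)%N by rewrite ltnS leq_maxr.
  by have := gL (maxn n m).+1 n; rewrite sL !nL// => /(_ nN)[_ _ /(_ m mN)]; rewrite nL.
pose A := [set v | exists M, forall n, (M <= n)%N -> (x n).1 v = 0].
have A0 : A 0 by exists 0%N => n _; exact: scalar_fun0 (cx n).1.
have AD a u v : A u -> A v -> A (a *: u + v).
  move=> [M hM] [N hN]; exists (maxn M N) => n; rewrite geq_max => /andP[Mn Nn].
  by rewrite (cx n).1 hM// hN// mulr0 addr0.
pose T := mk_subspace A0 AD.
have oT : open (T : set V).
  by apply: open_supspace oU _ => u Uu; exists 0%N => n _; exact: xU.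
have [| |v hv] := @compact_solve _ _
    (sub_linearly_compact (open_subspace_closed oT) lcV)
    [set ((x n).1 \o (@sub_val K V T), 1) | n in setT].
- move=> _ [n _ <-]; apply: cfun_comp (cx n).
  exact: subsp_val_continuous.
(* If only indices below [N] occur, the sum of the vectors with index below [N] is a solution; it
   lies in [T] because every later functional kills it. *)
- move=> s hs.
  have [N hN] : exists N, forall y, y \in s ->
      exists2 n, (n < N)%N & y = ((x n).1 \o (@sub_val K V T), 1).
    elim: s hs => [|y s IH] hs; first by exists 0%N.
    have [z zs|N hN] := IH; first by apply: hs; rewrite inE zs orbT.
    have [n _ ye] := hs _ (mem_head y s).
    exists (maxn N n.+1) => z; rewrite inE => /orP[/eqP ->|/hN[m mN ->]].
      by exists n => //; rewrite leq_maxr.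
    by exists m => //; rewrite (leq_trans mN)// leq_maxl.
  have xsum n : (x n).1 (\sum_(m < N) (x m).2) = (n < N)%:R.
    rewrite scalar_fun_sum; last exact: (cx n).1.
    under eq_bigr do rewrite xe.
    case: ltnP => nN.
      rewrite (bigD1 (Ordinal nN))//= eqxx big1 ?addr0// => i.
      by rewrite -val_eqE /= eq_sym => /negbTE ->.
    by rewrite big1// => i _; rewrite gtn_eqF// (leq_trans (ltn_ord i)).
  have Tsum : (T : set V) (\sum_(m < N) (x m).2).
    by exists N => n Nn; rewrite xsum ltnNge Nn.
  have [w we] := sub_val_surj Tsum.
  by exists w => _ /hN[n nN ->] /=; rewrite we xsum nN.
(* A common solution [v] in [T] is killed by the [M]-th functional, whose value there should be
   1. *)
- have [M hM] : (T : set V) (sub_val v) := subsp_valP v.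
  have /eqP := hv _ (ex_intro2 _ _ M I erefl).
  by rewrite /= hM// eq_sym oner_eq0.
Qed.

(** * The K[X]-module structure *)

Section PolynomialAction.
Variables (K : fieldType) (E : lmodType K) (T : {linear E -> E}).
Implicit Types (p q : {poly K}) (f : E -> K).

(** The operator p(T). The K[X]-module structure on functionals is precomposition with it: p sends
    [f] to [f \o act p]. *)
Definition act p (v : E) : E := \sum_(k < size p) p`_k *: iter k T v.

Lemma iter_linear k : linear (iter k T).
Proof. by elim: k => // k IH a x y; rewrite !iterS IH linearP. Qed.

Lemma act_widen n p v : (size p <= n)%N -> act p v = \sum_(k < n) p`_k *: iter k T v.
Proof.
move=> pn; rewrite /act (big_ord_widen _ (fun k => p`_k *: iter k T v) pn).
rewrite big_mkcond; apply: eq_bigr => k _; case: ltnP => // pk.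
by rewrite nth_default// scale0r.
Qed.

Lemma act0 v : act 0 v = 0.
Proof. by rewrite /act size_poly0 big_ord0. Qed.

Lemma actD p q v : act (p + q) v = act p v + act q v.
Proof.
pose n := maxn (size p) (size q).
rewrite (@act_widen n (p + q)) ?size_polyD// (@act_widen n p) ?leq_maxl//.
rewrite (@act_widen n q) ?leq_maxr// -big_split; apply: eq_bigr => k _ /=.
by rewrite coefD scalerDl.
Qed.

Lemma actC a v : act a%:P v = a *: v.
Proof. by rewrite (@act_widen 1) ?size_polyC ?leq_b1// big_ord1 coefC. Qed.

Lemma actMX p v : act (p * 'X) v = act p (T v).
Proof.
rewrite (@act_widen (size p).+1); last first.
  by have [->|/size_mulX ->//] := eqVneq p 0; rewrite mul0r size_poly0.
rewrite big_ord_recl coefMX scale0r add0r; apply: eq_bigr => k _.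
by rewrite coefMX /= -iterSr.
Qed.

Lemma act_linear p : linear (act p).
Proof.
move=> a x y; rewrite /act scaler_sumr -big_split; apply: eq_bigr => k _ /=.
by rewrite iter_linear scalerDr !scalerA mulrC.
Qed.

Lemma actT p v : act p (T v) = T (act p v).
Proof.
by rewrite /act linear_sum; apply: eq_bigr => k _; rewrite linearZ /= -iterSr.
Qed.

Lemma actZ a p v : act (a *: p) v = a *: act p v.
Proof.
rewrite (@act_widen (size p)) ?size_scale_leq// scaler_sumr.
by apply: eq_bigr => k _; rewrite coefZ scalerA.
Qed.

Lemma actM p q v : act (p * q) v = act p (act q v).
Proof.
elim/poly_ind: p v => [|p a IH] v; first by rewrite mul0r !act0.
rewrite mulrDl -mulrA ['X * q]mulrC mulrA !actD !actMX IH actT; congr (_ + _).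
by rewrite mul_polyC actZ actC.
Qed.

Lemma scalar_act f n p v : scalar f -> (size p <= n)%N ->
  f (act p v) = \sum_(k < n) p`_k * f (iter k T v).
Proof.
move=> sf pn; rewrite (act_widen _ pn) scalar_fun_sum//.
by apply: eq_bigr => k _; rewrite scalar_funZ.
Qed.

Lemma scalar_funcomp_act f p : scalar f -> scalar (f \o act p).
Proof. by move=> sf a x y /=; rewrite act_linear sf. Qed.

Lemma scalar_funcomp_iter f k : scalar f -> scalar (f \o iter k T).
Proof. by move=> sf a x y /=; rewrite iter_linear sf. Qed.

Definition poly_indep (I : finType) (S : {set I}) (f : I -> E -> K) : Prop :=
  forall p : I -> {poly K}, (forall v, \sum_(i in S) f i (act (p i) v) = 0) ->
    forall i, i \in S -> p i = 0.

Definition torsion f : Prop := exists2 p, p != 0 & forall v, f (act p v) = 0.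

Lemma poly_indep0 (I : finType) (f : I -> E -> K) : poly_indep finset.set0 f.
Proof. by move=> p _ i; rewrite finset.in_set0. Qed.

Lemma poly_indep1 f : ~ torsion f -> poly_indep [set: 'I_1]%SET (fun=> f).
Proof.
move=> nf p hp i _; apply: contrapT => /eqP pi0; apply: nf; exists (p i) => // v.
by rewrite -(hp v) (big_pred1 i)// => j; rewrite !ord1 inE /= eqxx.
Qed.

Lemma poly_indep_not_torsion (I : finType) (S : {set I}) (f : I -> E -> K) i :
  (forall j, scalar (f j)) -> poly_indep S f -> i \in S -> ~ torsion (f i).
Proof.
move=> sf fS iS [q q0 hq].
move/eqP: q0; apply; have := fS (fun j => if j == i then q else 0).
move=> /(_ _ i iS); rewrite eqxx; apply => v.
rewrite (bigD1 i)//= eqxx hq add0r big1// => j /andP[_ /negbTE ->].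
by rewrite act0 scalar_fun0.
Qed.

Lemma torsion_comb a f g : scalar f -> scalar g -> torsion f -> torsion g ->
  torsion (fun v => a * f v + g v).
Proof.
move=> sf sg [p p0 hp] [q q0 hq]; exists (p * q); first by rewrite mulf_neq0.
by move=> v; rewrite actM hp mulr0 add0r -actM mulrC actM hq.
Qed.

Lemma torsion_zero : torsion (fun=> 0).
Proof. by exists 1; rewrite ?oner_neq0. Qed.

Lemma torsion_comp f : torsion f -> torsion (f \o T).
Proof. by move=> [p p0 hp]; exists p => // v /=; rewrite -actT. Qed.

Lemma torsion_act f p : p != 0 -> torsion (f \o act p) -> torsion f.
Proof.
move=> p0 [q q0 hq]; exists (p * q); first by rewrite mulf_neq0.
by move=> v; rewrite actM; exact: hq.
Qed.

(** Independence over K[X] is independence over K of all the [f i \o iter k T], so [indep_onto_on]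
    applies to the finitely many with [k < n]. *)
Lemma poly_indep_solve (I : finType) (S : {set I}) (f : I -> E -> K) (n : nat)
    (c : I -> nat -> K) : (forall i, scalar (f i)) -> poly_indep S f ->
  exists v, forall i k, i \in S -> (k < n)%N -> f i (iter k T v) = c i k.
Proof.
move=> sf fS.
pose h (x : I * 'I_n) := f x.1 \o iter x.2 T.
have sh x : scalar (h x) by exact: scalar_funcomp_iter.
have [|v [_ hv]] := @indep_onto_on _ _ (full_subspace E) _ h sh
    [set x | x.1 \in S]%SET _ (fun x => c x.1 x.2).
  move=> b hb [i k]; rewrite inE /= => iS.
  (* The coefficients of a K-linear relation, gathered into one polynomial for each [i]; [insub]
     turns the natural number [k] into an ordinal. *)
  pose p i := \poly_(k < n) (if insub k is Some k' then b (i, k') else 0).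
  have bE : (p i)`_k = b (i, k) by rewrite coef_poly ltn_ord insubT//= => ?; congr (b (_, _)); apply: val_inj.
  rewrite -bE (fS p)// ?coef0// => v.
  rewrite -[RHS](hb v Logic.I).
  transitivity (\sum_(i in S) \sum_(k < n) b (i, k) * h (i, k) v); last first.
    by rewrite pair_big_dep; apply: eq_big => [[j l]|[j l] _] //; rewrite inE andbT.
  apply: eq_bigr => j _; rewrite (@scalar_act _ n)// ?size_poly//.
  apply: eq_bigr => l _; rewrite coef_poly ltn_ord; congr (_ * _).
  by rewrite insubT//= => ?; congr (b (_, _)); apply: val_inj.
by exists v => i k iS kn; apply: (hv (i, Ordinal kn)); rewrite inE.
Qed.

End PolynomialAction.

Lemma act_morph (K : fieldType) (E E' : lmodType K) (T : {linear E -> E})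
    (T' : {linear E' -> E'}) (g : {linear E -> E'}) (p : {poly K}) v :
  (forall v, g (T v) = T' (g v)) -> g (act T p v) = act T' p (g v).
Proof.
move=> gT; rewrite /act linear_sum; apply: eq_bigr => k _; rewrite linearZ /=.
by congr (_ *: _); elim: (k : nat) => // n IH; rewrite !iterS gT IH.
Qed.

(** * Dimension of a quotient *)

Section Dimension.
Variables (R : realType) (K : fieldType).

(** The coordinates of the first isomorphism are jointly onto and those of the second separate
    points, so [onto_on_card] compares their numbers. *)
Lemma vector_axiom_le (E : lmodType K) m n :
  Vector.axiom m E -> Vector.axiom n E -> (m <= n)%N.
Proof.
move=> [phi lphi [phi' phiK phi'K]] [psi lpsi [psi' psiK psi'K]].
pose h (i : 'I_m) v : K := phi v 0 i.
pose g := [seq (fun v : E => psi v 0 j : K) | j <- enum 'I_n].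
have sz : size g = n by rewrite size_map size_enum_ord.
rewrite -sz -[m]card_ord -cardsT.
apply: (@onto_on_card _ _ (full_subspace E) _ h).
- by move=> i a x y; rewrite /h lphi !mxE.
- move=> c; exists (phi' (\row_i c i)); split=> // i _.
  by rewrite /h phi'K mxE.
- by move=> _ /mapP[j _ ->] a x y; rewrite lpsi !mxE.
- move=> v _ hv i _; suff -> : v = 0.
    have := lphi 0 0 0; rewrite /h !scale0r add0r => e.
    have := lphi (-1) 0 0; rewrite scaler0 addr0 scaleN1r addNr => ->.
    by rewrite mxE.
  apply: (can_inj psiK); apply/rowP => j.
  have := lpsi (-1) 0 0; rewrite scaler0 addr0 scaleN1r addNr => ->.
  rewrite mxE; apply: (hv (fun v => psi v 0 j)).
  by apply: map_f; rewrite mem_enum.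
Qed.

Lemma dimension_axiom (E : lmodType K) n :
  Vector.axiom n E -> dimension R E = n%:R%:E.
Proof.
move=> ax; rewrite /dimension.
have -> : [set m%:R%:E | m in [set m | $|Vector.axiom m E| ]] = [set n%:R%:E : \bar R].
  apply/seteqP; split=> [_ [m [ax'] <-]|_ ->].
    suff -> : m = n by [].
    apply/eqP; rewrite eqn_leq (vector_axiom_le ax' ax).
    exact: vector_axiom_le ax ax'.
  by exists n => //; exact: squash.
exact: ereal_inf1.
Qed.

(** The functionals in [J] descend to the quotient, where they are jointly injective and onto: they
    are coordinates. *)
Lemma dimension_quot (V : topVect K) (Z : lsubspace V) (I : finType)
    (h : I -> V -> K) (J : {set I}) :
  (forall i, scalar (h i)) -> onto_on (full_subspace V) J h ->
  (forall v, (Z : set V) v <-> forall i, i \in J -> h i v = 0) ->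
  dimension R (quot_topvect Z) = #|J|%:R%:E.
Proof.
move=> sh oJ ZJ; apply: dimension_axiom.
pose phi (q : quot_topvect Z) : 'rV[K]_#|J| := \row_i h (enum_val i) (quotsp_repr q).
have phi_pi v : phi (quot_pi Z v) = \row_i h (enum_val i) v.
  apply/rowP => i; rewrite !mxE; apply/eqP; rewrite -subr_eq0 -scalar_funB//.
  apply/eqP; apply: (ZJ _).1; last exact: enum_valP.
  by apply/quotsp_piE; rewrite quotsp_reprK.
exists phi.
  move=> a p q; rewrite -[p]quotsp_reprK -[q]quotsp_reprK -!/(quot_pi Z _).
  rewrite -linearP !phi_pi; apply/rowP => i; rewrite !mxE.
  exact: sh.
have surj (r : 'rV[K]_#|J|) : exists q, phi q = r.
  (* The sum has at most one term; it transports the row [r] to a function on [I]. *)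
  have [v [_ hv]] := oJ (fun i => \sum_(k < #|J| | enum_val k == i) r 0 k).
  exists (quot_pi Z v); rewrite phi_pi; apply/rowP => i.
  rewrite mxE hv ?enum_valP// (bigD1 i)//= big1 ?addr0// => k.
  by rewrite (inj_eq enum_val_inj) => /andP[/eqP ->]; rewrite eqxx.
have [psi psiK] := choice surj.
exists psi => // q.
have inj : injective phi.
  move=> x y xy; rewrite -[x]quotsp_reprK -[y]quotsp_reprK.
  apply/quotsp_piE/ZJ => i iJ; rewrite scalar_funB//.
  have := congr1 (fun M : 'rV_#|J| => M 0 (enum_rank_in iJ i)) xy.
  by rewrite !mxE enum_rankK_in// => ->; rewrite subrr.
by apply: inj; rewrite psiK.
Qed.

End Dimension.

(** * Growth of the cotrajectory quotients *)

(** For positive [n] the terms lie between [s - C/n] and [s + C/n]. *)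
Lemma limn_linear_growth (R : realType) (a : nat -> \bar R) (s C : nat) :
  (forall n, exists d : nat,
    [/\ a n = d%:R%:E, (s * n <= d + C)%N & (d <= s * n + C)%N]) ->
  limn (fun n => (n%:R^-1)%:E * a n)%E = s%:R%:E.
Proof.
move=> /choice[d hd]; apply: cvg_lim => //.
have -> : (fun n => (n%:R^-1)%:E * a n)%E = (EFin \o (fun n => n%:R^-1 * (d n)%:R : R)).
  by apply/funext => n /=; case: (hd n) => -> _ _.
apply: cvg_EFin; first by near=> n.
have cinv : (fun n : nat => n%:R^-1 * C%:R : R) @ \oo --> (0 : R).
  rewrite -(@cvg_shiftS R).
  have := cvgM (@cvg_harmonic R) (@cvg_cst R (C%:R : R) nat \oo _).
  by rewrite mul0r; exact.
apply: (@squeeze_cvgr _ _ _ _ (fun n => s%:R - n%:R^-1 * C%:R)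
  (fun n => s%:R + n%:R^-1 * C%:R)).
- near=> n.
  have n0 : (0 : R) < n%:R by rewrite ltr0n; near: n; exact: nbhs_infty_gt.
  have [_ lo hi] := hd n.
  have e : n%:R^-1 * (d n)%:R = s%:R + n%:R^-1 * ((d n)%:R - s%:R * n%:R) :> R.
    by rewrite mulrBr mulrCA mulVf ?gt_eqF// mulr1 addrC subrK.
  rewrite /= e -mulrN !lerD2l !ler_pM2l ?invr_gt0// lerBrDr lerBlDl addrC -!natrM.
  by rewrite lerBlDr -!natrD !ler_nat lo.
- rewrite -[X in _ --> X]subr0; apply: cvgB => //; exact: cvg_cst.
- rewrite -[X in _ --> X]addr0; apply: cvgD => //; exact: cvg_cst.
Unshelve. all: by end_near.
Qed.

Section EntropyLimit.
Variables (R : realType) (K : fieldType) (F : flow K).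
Notation phi := (flow_map F).

Lemma cotrajectoryE (U : lsubspace F) n (v : F) :
  (cotrajectory U n : set F) v <-> forall k, (k < n)%N -> (U : set F) (iter k phi v).
Proof.
suff it k w : (iter k (preim_subspace phi) U : set F) w <-> (U : set F) (iter k phi w).
  by split=> [h k kn|h k kn]; apply/it; exact: h.
elim: k w => // k IH w; rewrite [iter _ phi w]iterSr; exact: IH (phi w).
Qed.

Lemma cfun_iter (f : F -> K) k : cfun f -> cfun (f \o iter k phi).
Proof.
move=> cf; elim: k => // k IH.
have -> : f \o iter k.+1 phi = (f \o iter k phi) \o phi.
  by apply/funext => v; rewrite /= -iterSr.
exact: cfun_comp (@flow_continuous _ F) IH.
Qed.

Lemma cfun_act (f : F -> K) p : cfun f -> cfun (f \o act phi p).
Proof.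
move=> cf; have -> : f \o act phi p =
    fun v => \sum_(k < size p) p`_k * (f \o iter k phi) v.
  by apply/funext => v /=; rewrite (@scalar_act _ _ _ _ (size p))//; exact: cf.1.
by apply: cfun_sum => k _; exact: cfun_iter.
Qed.

(** Linear compactness passes from the truncations [k < n] of [poly_indep_solve] to all [k] at
    once. *)
Lemma flow_solve (I : finType) (S : {set I}) (f : I -> F -> K) (c : I -> nat -> K) :
  (forall i, cfun (f i)) -> poly_indep phi S f ->
  exists v, forall i k, i \in S -> f i (iter k phi v) = c i k.
Proof.
move=> cf fS.
have [| |v hv] := compact_solve (flow_linearly_compact F)
    (S := [set x | exists i k, i \in S /\ x = (f i \o iter k phi, c i k)]).
- by move=> _ [i [k [_ ->]]]; exact: cfun_iter.
- move=> s hs.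
  have [n hn] : exists n, forall x, x \in s -> exists i k,
      [/\ i \in S, (k < n)%N & x = (f i \o iter k phi, c i k)].
    elim: s hs => [|y s IH] hs; first by exists 0%N.
    have [z zs|n hn] := IH; first by apply: hs; rewrite inE zs orbT.
    have [j [l [jS ye]]] := hs _ (mem_head y s).
    exists (maxn n l.+1) => x; rewrite inE => /orP[/eqP ->|/hn[i [k [iS kn ->]]]].
      by exists j, l; split=> //; rewrite leq_maxr.
    by exists i, k; split=> //; rewrite (leq_trans kn)// leq_maxl.
  have [v hv] := poly_indep_solve n c (fun i => (cf i).1) fS.
  by exists v => x /hn[i [k [iS kn ->]]] /=; exact: hv.
- by exists v => i k iS; apply: (hv (f i \o iter k phi, c i k)); exists i, k.
Qed.

Section FiniteFamily.
Variables (I : finType) (S : {set I}) (f : I -> F -> K) (U : lsubspace F).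
Hypothesis sf : forall i, scalar (f i).
Hypothesis Uf : forall v, (U : set F) v <-> forall i, f i v = 0.
Hypothesis fS : poly_indep phi S f.
Hypothesis maxS : forall j, j \notin S -> ~ poly_indep phi (j |: S) f.

(** By maximality of [S], adjoining [j] creates a relation, and [p j] cannot vanish since [S] is
    independent. The condition on [j] stands under the existential so that [choice] covers all
    [j]. *)
Lemma max_poly_indep_relation j : exists p : I -> {poly K}, j \notin S ->
  p j != 0 /\ forall v, f j (act phi (p j) v) + \sum_(i in S) f i (act phi (p i) v) = 0.
Proof.
have [jS|jS] := boolP (j \in S); first by exists (fun=> 0).
have [p [hp np]] : exists p : I -> {poly K},
    (forall v, \sum_(i in j |: S) f i (act phi (p i) v) = 0) /\
    ~ forall i, i \in j |: S -> p i = 0.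
  apply: contrapT => nex; apply: (maxS jS) => p hp.
  by apply: contrapT => np; apply: nex; exists p.
have hp' v : f j (act phi (p j) v) + \sum_(i in S) f i (act phi (p i) v) = 0.
  by rewrite -[RHS](hp v) big_setU1.
exists p => _; split=> //; apply/eqP => pj0; apply: np => i.
rewrite in_setU1 => /orP[/eqP ->//|]; apply: fS => v.
by rewrite -[RHS](hp' v) pj0 act0 scalar_fun0// add0r.
Qed.

(** The relation for [j] acts as a linear recurrence: it determines [f j] on the [k]-th iterate from
    its values on earlier iterates and from the family [S]. Boundedly many initial values and the
    values of [S] thus decide everything. *)
Lemma cotrajectory_kernel : exists B : nat, forall n v,
  (forall i l, (l < B)%N -> f i (iter l phi v) = 0) ->
  (forall i l, i \in S -> (l < n + B)%N -> f i (iter l phi v) = 0) ->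
  forall j k, (k < n)%N -> f j (iter k phi v) = 0.
Proof.
have [p hp] := choice max_poly_indep_relation.
pose B := (\max_j \max_i size (p j i))%N.
have pB j i : (size (p j i) <= B)%N.
  exact: leq_trans (leq_bigmax i) (leq_bigmax (F := fun j => \max_i size (p j i)) j).
exists B => n v hB hS j.
have [jS k kn|jS] := boolP (j \in S).
  by apply: hS => //; rewrite (leq_trans kn)// leq_addr.
have [pj0 rel] := hp j jS.
elim/ltn_ind => k IH kn.
have [kB|Bk] := ltnP k B; first exact: hB.
pose m := (size (p j j)).-1.
have sm : size (p j j) = m.+1 by rewrite prednK// size_poly_gt0.
have mk : (m <= k)%N by rewrite (leq_trans _ Bk)// (leq_trans _ (pB j j))// sm.
(* Here [m] is the degree of [p j j], so at this vector the leading term carries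
   [f j (iter k phi v)]; all other terms vanish. *)
have := rel (iter (k - m) phi v).
rewrite (@scalar_act _ _ _ _ m.+1)// ?sm// big_ord_recr /=.
rewrite -iterD subnKC// big1 ?add0r; last first.
  move=> l _; rewrite -iterD IH ?mulr0//.
    by rewrite -[X in (_ < X)%N](subnKC mk) ltn_add2r.
  by apply: leq_ltn_trans kn; rewrite -[X in (_ <= X)%N](subnKC mk) leq_add2r ltnW.
rewrite big1 ?addr0; last first.
  move=> i iS; rewrite (@scalar_act _ _ _ _ B)// big1// => l _.
  rewrite -iterD hS ?mulr0// addnC.
  by rewrite -addnS leq_add// (leq_trans (leq_subr _ _) (ltnW kn)).
by move=> /eqP; rewrite mulf_eq0 -/(lead_coef _) lead_coef_eq0 (negbTE pj0) => /eqP.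
Qed.

(** The dimension is the size of a maximal [J] for which the [f i \o iter k phi], [k < n], are onto
    on [U]. Both bounds come from [onto_on_card]. *)
Lemma dimension_cotrajectory : exists C : nat, forall n, exists d : nat,
  [/\ dimension R (cotrajectory_quotient U n) = d%:R%:E,
      (#|S| * n <= d + C)%N & (d <= #|S| * n + C)%N].
Proof.
have [B hB] := cotrajectory_kernel.
(* [#|I|] is the error of the lower bound, where [f] is added to cut out [U]; the two products are
   the error of the upper bound. *)
exists (#|I| * B + #|S| * B + #|I|)%N => n.
pose h (x : I * 'I_n) := f x.1 \o iter x.2 phi.
have sh x : scalar (h x) by exact: scalar_funcomp_iter.
have [J [_ oJ kJ]] := max_onto_on U sh finset.setT.
exists #|J|; split.
- apply: (@dimension_quot _ _ _ _ _ (fun x => h x \o @sub_val K F U)).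
  + by move=> x a v w; rewrite /= linearP sh.
  + move=> c; have [v [Uv hv]] := oJ c.
    by have [w wv] := sub_val_surj Uv; exists w; split=> // i iJ; rewrite /= wv hv.
  + move=> v; split=> [/cotrajectoryE hv [i k] _|hv].
      by have /Uf := hv _ (ltn_ord k); exact.
    apply/cotrajectoryE => k kn; apply/Uf => i.
    by apply: (kJ (sub_val v) (subsp_valP v) _ (i, Ordinal kn)) => //; rewrite inE.
- have -> : (#|S| * n = #|[set x : I * 'I_n | x.1 \in S]%SET|)%N.
    rewrite -[n in LHS]card_ord -[X in (_ * X)%N]cardsT -cardsX.
    by apply: eq_card => x; rewrite !inE andbT.
  (* On the whole space the [#|S| * n] functionals are onto. They vanish once [f] vanishes, which
     puts [v] in [U], and [J] does. *)
  pose g := [seq h x | x <- enum J] ++ [seq f i | i <- enum I].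
  apply: leq_trans (_ : size g <= _)%N; last first.
    by rewrite size_cat !size_map -!cardE -enumT -cardE leq_add2l leq_addl.
  apply: (@onto_on_card _ _ (full_subspace F) _ h sh).
  + move=> c.
    have [v hv] := poly_indep_solve n
      (fun i k => if insub k is Some k' then c (i, k') else 0) sf fS.
    exists v; split=> // -[i k]; rewrite inE => iS.
    rewrite /h /= hv// insubT//= => ?; congr (c (_, _)); exact: val_inj.
  + by move=> x; rewrite mem_cat => /orP[]/mapP[y _ ->].
  + move=> v _ hv x _.
    have gv y : y \in g -> y v = 0 by exact: hv.
    apply: kJ => //.
    * apply/Uf => i; apply: gv; rewrite mem_cat; apply/orP; right.
      by apply: map_f; rewrite mem_enum.
    * move=> y yJ; apply: gv; rewrite mem_cat; apply/orP; left.
      by apply: map_f; rewrite mem_enum.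
(* These are the values that suffice by [cotrajectory_kernel]. *)
- pose g := [seq f i \o iter l phi | i <- enum I, l <- iota 0 B] ++
            [seq f i \o iter l phi | i <- enum S, l <- iota 0 (n + B)].
  apply: leq_trans (_ : size g <= _)%N; last first.
    rewrite size_cat !size_allpairs -!cardE !size_iota mulnDr.
    by rewrite addnC -!addnA leq_add2l addnCA addnA leq_addr.
  apply: (onto_on_card sh oJ).
  + by move=> x; rewrite mem_cat => /orP[]/allpairsP[[i l] [_ _ ->]];
      exact: scalar_funcomp_iter.
  + move=> v Uv gv [i k] _; apply: (hB n v).
    * move=> j l lB; apply: (gv (f j \o iter l phi)); rewrite mem_cat; apply/orP; left.
      by apply: allpairs_f; rewrite ?mem_enum// mem_iota.
    * move=> j l jS lB; apply: (gv (f j \o iter l phi)); rewrite mem_cat.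
      by apply/orP; right; apply: allpairs_f; rewrite ?mem_enum// mem_iota.
    * exact: ltn_ord.
Qed.

End FiniteFamily.
End EntropyLimit.

(** * Entropy is the rank *)

(* The rank over K[X] of the module of continuous functionals. *)
Definition rank (R : realType) (K : fieldType) (F : flow K) : \bar R :=
  ereal_sup [set n%:R%:E | n in [set n | exists m (f : 'I_m -> F -> K) (S : {set 'I_m}),
    [/\ forall i, cfun (f i), poly_indep (flow_map F) S f & n = #|S|]]].

Section Rank.
Variables (R : realType) (K : fieldType) (F : flow K).
Notation phi := (flow_map F).

Lemma rank_ge m (f : 'I_m -> F -> K) (S : {set 'I_m}) :
  (forall i, cfun (f i)) -> poly_indep phi S f -> (#|S|%:R%:E <= rank R F)%E.
Proof.
by move=> cf fS; apply: ereal_sup_ubound; exists #|S| => //; exists m, f, S.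
Qed.

(** The maximal independent [S] is grown from a prescribed [S0], so that the limit is at least
    [#|S0|]; the lower bound on the entropy uses this. *)
Lemma entropy_limit (m : nat) (f : 'I_m -> F -> K) (U : lsubspace F) (S0 : {set 'I_m}) :
  (forall i, scalar (f i)) -> (forall v, (U : set F) v <-> forall i, f i v = 0) ->
  poly_indep phi S0 f ->
  exists S : {set 'I_m}, [/\ S0 \subset S, poly_indep phi S f &
    limn (fun n => (n%:R^-1)%:E * dimension R (cotrajectory_quotient U n))%E
      = #|S|%:R%:E].
Proof.
move=> sf Uf fS0.
pose P := fun S : {set 'I_m} => `[< poly_indep phi S f >].
have P0 : P S0 by exact/asboolP.
have [S /maxsetP[/asboolP fS maxS] S0S] := maxset_exists P0.
exists S; split=> //.
have [j jS /asboolP fjS|C hC] := dimension_cotrajectory R sf Uf fS.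
  move: jS; rewrite -(maxS _ fjS) ?setU11//; exact: finset.subsetUr.
exact: limn_linear_growth hC.
Qed.

Lemma ent_star_rank : ent_star R F = rank R F.
Proof.
apply/eqP; rewrite eq_le; apply/andP; split.
  apply: ge_ereal_sup => _ [U [oU _] <-].
  have [m [f [cf Uf]]] := open_subspace_kernels (flow_linearly_compact F) oU.
  have [S [_ fS ->]] := entropy_limit (fun i => (cf i).1) Uf (@poly_indep0 _ _ phi _ f).
  exact: rank_ge.
apply: ge_ereal_sup => _ [_ [m [f [S0 [cf fS0 ->]]]] <-].
(* The common kernel of an independent family is open and realizes an entropy limit at least the
   size of the family. *)
pose U := @mk_subspace K F [set v | forall i, f i v = 0]
  (fun i => scalar_fun0 (cf i).1)
  (fun a x y fx fy i => ker_subproof (cf i).1 a (fx i) (fy i)).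
have Uf v : (U : set F) v <-> forall i, f i v = 0 by [].
have [S [S0S fS limS]] := entropy_limit (fun i => (cf i).1) Uf fS0.
have oU : open (U : set F).
  apply: subspace_nbhs_open.
  apply: filter_forall => i; apply: open_nbhs_nbhs; split; first exact: (cf i).2.
  exact: scalar_fun0 (cf i).1.
apply: (@le_trans _ _ #|S|%:R%:E); first by rewrite lee_fin ler_nat subset_leq_card.
rewrite -limS; apply: ereal_sup_ubound; exists U => //; split=> //.
apply: sub_linearly_compact; first exact: open_subspace_closed.
exact: flow_linearly_compact.
Qed.

Lemma rank_neq0 : rank R F <> 0%E <-> exists2 f : F -> K, cfun f & ~ torsion phi f.
Proof.
split=> [nF|[f cf nf] rF0]; last first.
  have := @rank_ge 1 (fun=> f) finset.setT (fun=> cf) (poly_indep1 nf).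
  by rewrite rF0 cardsT card_ord lee_fin ler10.
apply: contrapT => nex; apply: nF.
apply/eqP; rewrite eq_le; apply/andP; split; last first.
  have := @rank_ge 0 (fun _ _ => 0) finset.set0 (fun=> cfun0 F) (@poly_indep0 _ _ phi _ _).
  by rewrite cards0.
apply: ge_ereal_sup => _ [_ [m [f [S [cf fS ->]]]] <-].
rewrite lee_fin -[0]/(0%:R) ler_nat leqn0 cards_eq0; apply/eqP/setP => i.
rewrite inE; apply/negbTE/negP => iS; apply: nex; exists (f i) => //.
exact: poly_indep_not_torsion (fun i => (cf i).1) fS iS.
Qed.

End Rank.

(** * Functionals on subflows and quotient flows *)

Section SubQuotient.
Variables (K : fieldType) (F : flow K) (Z : lsubspace F) (hZ : closed_invariant Z).
Notation phi := (flow_map F).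

Lemma act_sub p w : sub_val (act (flow_map (subflow hZ)) p w) = act phi p (sub_val w).
Proof. exact: act_morph. Qed.

Lemma act_quot p v : quot_pi Z (act phi p v) = act (flow_map (quotflow hZ)) p (quot_pi Z v).
Proof. by apply: act_morph => w; exact: esym (quotflow_map_pi hZ w). Qed.

Lemma cfun_sub (f : F -> K) : cfun f -> cfun (f \o @sub_val K F Z).
Proof. by apply: cfun_comp; exact: subsp_val_continuous. Qed.

Lemma torsion_sub (f : F -> K) : torsion phi f ->
  torsion (flow_map (subflow hZ)) (f \o @sub_val K F Z).
Proof. by move=> [p p0 hp]; exists p => // w; rewrite /= act_sub. Qed.

Lemma cfun_quot (g : quot_topvect Z -> K) : cfun g -> cfun (g \o quot_pi Z).
Proof. by apply: cfun_comp; exact: quotsp_pi_continuous. Qed.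

Lemma torsion_quot (g : quot_topvect Z -> K) :
  torsion phi (g \o quot_pi Z) -> torsion (flow_map (quotflow hZ)) g.
Proof.
move=> [p p0 hp]; exists p => // q.
by rewrite -[q]quotsp_reprK -/(quot_pi Z _) -act_quot; exact: hp.
Qed.

Lemma torsion_quot_pi (g : quot_topvect Z -> K) :
  torsion (flow_map (quotflow hZ)) g -> torsion phi (g \o quot_pi Z).
Proof. by move=> [p p0 hp]; exists p => // v; rewrite /= act_quot. Qed.

Lemma cfun_quot_lift (f : F -> K) : cfun f -> (forall z, (Z : set F) z -> f z = 0) ->
  exists2 g : quot_topvect Z -> K, cfun g & f = g \o quot_pi Z.
Proof.
move=> [sf of_] fZ; pose g (q : quot_topvect Z) := f (quotsp_repr q).
have gE v : g (quot_pi Z v) = f v.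
  apply/eqP; rewrite /g -subr_eq0 -(scalar_funB _ _ sf); apply/eqP/fZ.
  by apply/quotsp_piE; rewrite quotsp_reprK.
exists g; last by apply/funext => v; rewrite /= gE.
split.
  move=> a p q; rewrite -[p]quotsp_reprK -[q]quotsp_reprK -!/(quot_pi Z _).
  by rewrite -linearP !gE sf.
rewrite quotsp_openE.
by have -> : @quotsp_pi K F Z @^-1` [set q | g q = 0] = [set v | f v = 0]
  by apply/seteqP; split=> v /=; rewrite -/(quot_pi Z v) gE.
Qed.

(** Restrictions of functionals on [F] form a subspace of the dual of [Z] that separates points, so
    by [compact_span] on [Z] they are the whole dual. *)
Lemma cfun_sub_extend (g : sub_topvect Z -> K) : cfun g ->
  exists2 f : F -> K, cfun f & g = f \o @sub_val K F Z.
Proof.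
move=> cg; have lcF := flow_linearly_compact F.
apply: (compact_span (sub_linearly_compact hZ.1 lcF)
  (N := [set g | exists2 f : F -> K, cfun f & g = f \o @sub_val K F Z])) => //.
- by exists (fun=> 0) => //; exact: cfun0.
- move=> a _ _ [f cf ->] [h ch ->]; exists (fun v => a * f v + h v) => //.
  exact: cfun_comb.
- by move=> _ [f cf ->]; exact: cfun_sub.
- move=> w hw; suff -> : w = 0 by exact: scalar_fun0 cg.1.
  apply: (@subsp_val_inj K F Z); rewrite linear0; apply: contrapT => w0.
  have c0 : closed [set 0 : F].
    by apply: accessible_closed_set1; apply: hausdorff_accessible; case: lcF => -[].
  have OD (a : K) (x y : F) : [set 0] x -> [set 0] y -> [set 0] (a *: x + y).
    by move=> -> ->; rewrite scaler0 addr0.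
  have [f [cf _ fw]] := @closed_separation K F (mk_subspace erefl OD) _ lcF.1 c0 w0.
  have /eqP := hw (f \o @sub_val K F Z) (ex_intro2 _ _ f cf erefl).
  by rewrite /= [f _]fw oner_eq0.
Qed.

End SubQuotient.

(** * The largest subspace with completely positive entropy *)

Section CompletelyPositivePart.
Variables (K : fieldType) (F : flow K).
Notation phi := (flow_map F).

Definition torsion_annihilator_set : set F :=
  [set v | forall f, cfun f -> torsion phi f -> f v = 0].

Lemma torsion_annihilator0 : torsion_annihilator_set 0.
Proof. by move=> f cf _; exact: scalar_fun0 cf.1. Qed.

Lemma torsion_annihilator_comb a x y : torsion_annihilator_set x ->
  torsion_annihilator_set y -> torsion_annihilator_set (a *: x + y).
Proof. by move=> hx hy f cf tf; rewrite cf.1 hx// hy// mulr0 addr0. Qed.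

Definition torsion_annihilator : lsubspace F :=
  mk_subspace torsion_annihilator0 torsion_annihilator_comb.

Lemma torsion_annihilator_closed_invariant : closed_invariant torsion_annihilator.
Proof.
split; last first.
  move=> _ [v hv <-] f cf tf.
  apply: (hv (f \o phi)); last exact: torsion_comp.
  by apply: cfun_comp cf; exact: flow_continuous.
have -> : (torsion_annihilator : set F) =
    \bigcap_(f in [set f | cfun f /\ torsion phi f]) (f @^-1` [set 0]).
  by apply/seteqP; split=> v hv f; [case; exact: hv|move=> cf tf; exact: hv].
by apply: closed_bigI => f [cf _]; exact: cfun_closed_preimage.
Qed.

(** The torsion functionals form a subspace of the dual, so [compact_span] identifies it with its
    double annihilator. *)
Lemma torsion_annihilatorP (f : F -> K) : cfun f ->
  (forall v, (torsion_annihilator : set F) v -> f v = 0) -> torsion phi f.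
Proof.
move=> cf hf.
suff [] : [set f | cfun f /\ torsion phi f] f by [].
apply: (compact_span (flow_linearly_compact F)) => //.
- by split; [exact: cfun0|exact: torsion_zero].
- move=> a g h [cg tg] [ch th]; split; first exact: cfun_comb.
  by apply: torsion_comb => //; [exact: cg.1|exact: ch.1].
- by move=> g [].
- by move=> v hv; apply: hf => g cg tg; exact: hv.
Qed.

Variables (D : lsubspace F) (hD : closed_invariant D).
Hypothesis DE : D = torsion_annihilator.

(** Extend [g] to [f] on [F]. As [f \o act p] vanishes on [D], it is torsion, so [f] is torsion and
    vanishes on [D]. Keeping [D] and [hD] abstract lets this apply to [D_plus], which has its own
    invariance proof. *)
Lemma torsion_free_sub (g : sub_topvect D -> K) : cfun g ->
  torsion (flow_map (subflow hD)) g -> forall w, g w = 0.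
Proof.
move=> cg [p p0 hp] w; have [f cf ge] := cfun_sub_extend hD cg.
rewrite ge /=.
have tf : torsion phi f.
  apply: (torsion_act p0); apply: torsion_annihilatorP; first exact: cfun_act.
  rewrite -DE => v Dv; have [u uv] := sub_val_surj Dv.
  by rewrite /= -uv -(@act_sub _ _ _ hD) -[RHS](hp u) ge.
have DT v : (D : set F) v -> (torsion_annihilator : set F) v by rewrite DE.
exact: (DT _ (subsp_valP w)).
Qed.

(** A nonzero functional on [D] vanishing on [Z] descends to the quotient; it is not torsion there
    because the dual of [D] is torsion-free. *)
Lemma cpe_sub (R : realType) : completely_positive_entropy R (subflow hD).
Proof.
move=> Z hZ ZT; rewrite ent_star_rank; apply/rank_neq0.
have [w Zw] : exists w, ~ (Z : set (subflow hD)) w.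
  apply: contrapT => nex; apply: ZT; apply/seteqP; split=> // w _.
  by apply: contrapT => Zw; apply: nex; exists w.
have [g [cg gZ gw]] := closed_separation (flow_linearly_compact (subflow hD)).1 hZ.1 Zw.
have [h ch gh] := cfun_quot_lift cg gZ.
exists h => // /torsion_quot_pi; rewrite -gh => /(torsion_free_sub cg)/(_ w)/eqP.
by rewrite gw oner_eq0.
Qed.

(** Let [W] be the part of [Z] killed by all torsion functionals. If it were proper, the quotient by
    [W] would carry a non-torsion functional; pulled back to [Z] it vanishes on [W], so by
    [compact_span] it is the restriction of a torsion functional, a contradiction. *)
Lemma cpe_subset (R : realType) (Z : lsubspace F) (hZ : closed_invariant Z) :
  completely_positive_entropy R (subflow hZ) -> (Z : set F) `<=` D.
Proof.
move=> cpeZ; rewrite DE.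
pose W : lsubspace (subflow hZ) := preim_subspace (@sub_val K F Z) torsion_annihilator.
have [cT iT] := torsion_annihilator_closed_invariant.
have hW : closed_invariant W.
  split.
    apply: (@closed_comp (sub_topvect Z) F) => // x _; exact: subsp_val_continuous.
  by move=> _ [w Ww <-]; apply: iT; exists (sub_val w).
have [WT z Zz|WT] := pselect ((W : set (subflow hZ)) = setT).
  have [w <-] := sub_val_surj Zz.
  by have : (W : set (subflow hZ)) w by rewrite WT.
exfalso; have := cpeZ W hW WT; rewrite ent_star_rank => /rank_neq0[g cg]; apply.
apply: torsion_quot.
suff [f [_ tf ->]] : [set h | exists f, [/\ cfun f, torsion phi f &
    h = f \o @sub_val K F Z]] (g \o quot_pi W) by exact: torsion_sub.
apply: (compact_span (flow_linearly_compact (subflow hZ))) => //.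
- by exists (fun=> 0); split=> //; [exact: cfun0|exact: torsion_zero].
- move=> a _ _ [f [cf tf ->]] [h [ch th ->]].
  exists (fun v => a * f v + h v); split=> //; first exact: cfun_comb.
  by apply: torsion_comb => //; [exact: cf.1|exact: ch.1].
- by move=> _ [f [cf _ ->]]; exact: cfun_sub.
- exact: cfun_quot.
- move=> w hw; have Ww : (W : set (subflow hZ)) w.
    by move=> f cf tf; apply: (hw (f \o @sub_val K F Z)); exists f.
  have -> : (g \o quot_pi W) w = g (quot_pi W 0).
    by congr g; apply/quotsp_piE; rewrite subr0.
  by rewrite linear0; exact: scalar_fun0 cg.1.
Qed.

(** Restriction to [D] is the passage to the quotient of the dual by its torsion, which preserves
    rank. *)
Lemma rank_sub (R : realType) : rank R (subflow hD) = rank R F.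
Proof.
congr ereal_sup; congr image; apply/seteqP; split=> n [m [f [S [cf fS ->]]]].
  have ext i : exists h : F -> K, cfun h /\ f i = h \o @sub_val K F D.
    by have [h ch e] := cfun_sub_extend hD (cf i); exists h.
  have [h hh] := choice ext.
  exists m, h, S; split=> //; first by move=> i; case: (hh i).
  move=> p hp; apply: fS => w; rewrite -[RHS](hp (sub_val w)).
  by apply: eq_bigr => i _; rewrite (hh i).2 /= act_sub.
exists m, (fun i => f i \o @sub_val K F D), S; split=> //.
  by move=> i; exact: cfun_sub.
move=> p hp.
pose g v := \sum_(i in S) 1 * (f i \o act phi (p i)) v.
have gE v : g v = \sum_(i in S) f i (act phi (p i) v).
  by apply: eq_bigr => i _; rewrite mul1r.
(* A relation on [D] holds on [F] only up to torsion; multiplying it by [q] gives a true relation on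
   [F]. *)
have [q q0 hq] : torsion phi g.
  apply: torsion_annihilatorP.
    by apply: cfun_sum => i _; exact: cfun_act.
  rewrite -DE => v Dv; have [u uv] := sub_val_surj Dv.
  by rewrite gE -[RHS](hp u) -uv; apply: eq_bigr => i _; rewrite /= act_sub.
move=> i iS; have := fS (fun i => p i * q).
move=> /(_ _ i iS)/eqP; rewrite mulf_eq0 (negbTE q0) orbF => H; apply/eqP/H => v.
by rewrite -[RHS](hq v) gE; apply: eq_bigr => j _; rewrite actM.
Qed.

End CompletelyPositivePart.

Lemma D_plusE (R : realType) (K : fieldType) (F : flow K) :
  D_plus R F = torsion_annihilator F.
Proof.
pose T := torsion_annihilator F.
have hT := torsion_annihilator_closed_invariant F.
have cT : largest_cpe R T.
  split; first by exists hT; exact: cpe_sub.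
  by move=> Z hZ; exact: cpe_subset.
rewrite /D_plus; case: xgetP => [D _ [[hD cD] maxD]|/(_ T)//].
apply: subspace_ext; apply/seteqP; split.
  exact: cpe_subset cD.
by apply: maxD; exact: (@cpe_sub _ _ _ hT).
Qed.

(** * Dual Goldie dimension *)

Section DualGoldie.
Variables (R : realType) (K : fieldType) (F : flow K).
Notation phi := (flow_map F).

Lemma act_invariant (N : lsubspace F) p v :
  closed_invariant N -> (N : set F) v -> (N : set F) (act phi p v).
Proof.
move=> hN Nv; apply: subspace_sum => k _; apply: subspaceZ.
by elim: (k : nat) => // n IH; rewrite iterS; apply: hN.2; exists (iter n phi v).
Qed.

(** The annihilator of the cyclic submodule generated by [f], that is, the largest invariant
    subspace inside the kernel of [f]. *)
Definition orbit_kernel (f : F -> K) (cf : cfun f) : lsubspace F :=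
  @mk_subspace K F [set v | forall k, f (iter k phi v) = 0]
    (fun k => scalar_fun0 (scalar_funcomp_iter phi k cf.1))
    (fun a x y hx hy k =>
      ker_subproof (scalar_funcomp_iter phi k cf.1) a (hx k) (hy k)).

Lemma orbit_kernel_closed_invariant (f : F -> K) (cf : cfun f) :
  closed_invariant (orbit_kernel cf).
Proof.
split; last by move=> _ [v hv <-] k; rewrite -iterSr; exact: hv.
have -> : (orbit_kernel cf : set F) =
    \bigcap_(k in [set: nat]) ((f \o iter k phi) @^-1` [set 0]).
  by apply/seteqP; split=> v hv k; [move=> _|]; exact: hv.
by apply: closed_bigI => k _; apply: cfun_closed_preimage; exact: cfun_iter.
Qed.

Lemma poly_indep_coindependent (m : nat) (f : 'I_m -> F -> K) (S : {set 'I_m}) :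
  (forall i, cfun (f i)) -> poly_indep phi S f ->
  exists2 C : set (lsubspace F), (C #= `I_#|S|)%card & coindependent_finite C.
Proof.
move=> cf fS.
pose N (k : 'I_#|S|) := orbit_kernel (cf (enum_val k)).
have solve (c : 'I_#|S| -> nat -> K) : exists v,
    forall k l, f (enum_val k) (iter l phi v) = c k l.
  have [v hv] := flow_solve
    (fun i l => \sum_(k < #|S| | enum_val k == i) c k l) cf fS.
  exists v => k l; rewrite hv ?enum_valP// (bigD1 k)//= big1 ?addr0// => j.
  by rewrite (inj_eq enum_val_inj) => /andP[/eqP ->]; rewrite eqxx.
(* These vectors show that the [N k] are proper and pairwise distinct, so that the family has
   exactly [#|S|] members. *)
have dual k : exists v, ~ (N k : set F) v /\ forall j, j != k -> (N j : set F) v.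
  have [v hv] := solve (fun j _ => (j == k)%:R).
  exists v; split=> [/(_ 0%N)/eqP|j jk l]; last by rewrite hv (negbTE jk).
  by rewrite hv eqxx oner_eq0.
have Ninj : injective N.
  move=> j k jk; apply: contrapT => /eqP njk.
  by have [v [nv /(_ _ njk)]] := dual k; rewrite jk.
exists [set N k | k in setT].
  apply: card_eq_trans (_ : [set: 'I_#|S|] #= _)%card.
    by apply: inj_card_eq => j k _ _; exact: Ninj.
  by rewrite card_eq_sym card_II.
split.
- exact: finite_image finite_finset.
- move=> _ [k _ <-]; split; first exact: orbit_kernel_closed_invariant.
  by have [v [nv _]] := dual k => NT; apply: nv; rewrite NT.
- move=> _ [k _ <-]; apply/seteqP; split=> // v _.
  (* Split [v] as [w + (v - w)]: [w] lies in [N k] and agrees with [v] under all other functionals,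
     so [v - w] lies in every other [N j]. *)
  have [w hw] := solve (fun j l => if j == k then 0 else f (enum_val j) (iter l phi v)).
  exists w; first by move=> l; rewrite hw eqxx.
  exists (v - w); last by rewrite addrCA subrr addr0.
  move=> _ [[j _ <-] jk] l.
  have sfl := scalar_funcomp_iter phi l (cf (enum_val j)).1.
  rewrite -[LHS]/((f (enum_val j) \o iter l phi) (v - w)) (scalar_funB _ _ sfl) /= hw.
  by case: eqVneq jk => [->|_ _]; [case|rewrite subrr].
Qed.

Hypothesis torsion_free : forall g : F -> K, cfun g -> torsion phi g -> forall v, g v = 0.

(** Choose nonzero [g i] vanishing on [N i]. In a relation among them, the [i]-th term vanishes on
    [N i] and on the intersection of the other members, hence everywhere; torsion-freeness then
    forces its polynomial to be zero. *)
Lemma coindependent_le_rank (C : set (lsubspace F)) n :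
  (C #= `I_n)%card -> coindependent_finite C -> (n%:R%:E <= rank R F)%E.
Proof.
move=> Cn [finC properC sumC].
pose N (i : 'I_n) := nth (full_subspace F) (fset_set C) i.
have sz : size (fset_set C) = n by exact: card_fset_set Cn.
have CN i : C (N i).
  by apply/set_mem; rewrite -(in_fset_set finC) mem_nth// sz.
have Ninj : injective N.
  by move=> i j /eqP; rewrite nth_uniq ?sz ?fset_uniq// => /eqP/val_inj.
have sep i : exists g : F -> K,
    [/\ cfun g, forall v, (N i : set F) v -> g v = 0 & exists v, g v <> 0].
  have [[cN _] NT] := properC _ (CN i).
  have [v Nv] : exists v, ~ (N i : set F) v.
    apply: contrapT => nex; apply: NT; apply/seteqP; split=> // v _.
    by apply: contrapT => Nv; apply: nex; exists v.
  have [g [cg gN gv]] := closed_separation (flow_linearly_compact F).1 cN Nv.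
  by exists g; split=> //; exists v; rewrite gv; apply/eqP; exact: oner_neq0.
have [g hg] := choice sep.
have cg i : cfun (g i) by case: (hg i).
have gN i p v : (N i : set F) v -> g i (act phi p v) = 0.
  by case: (hg i) => _ gN _ Nv; apply: gN; apply: act_invariant => //; case: (properC _ (CN i)).
rewrite -[n]card_ord -cardsT.
apply: (@rank_ge R K F n g _ cg) => p hp i _.
apply: contrapT => /eqP pi0; case: (hg i) => _ _ [v]; apply.
apply: torsion_free => //; exists (p i) => // u.
have : [set: F] u by [].
rewrite -(sumC _ (CN i)) => -[x Nx [y hy <-]].
have sgp := scalar_funcomp_act phi (p i) (cg i).1.
rewrite -[LHS]/((g i \o act phi (p i)) (x + y)) (scalar_funD _ _ sgp) /= gN// add0r.
(* On [y], which lies in all other members, only the [i]-th term of the relation survives. *)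
rewrite -[RHS](hp y) (bigD1 i) ?inE//= big1 ?addr0// => j /andP[_ ji].
apply: gN; apply: hy; split; first exact: CN.
by move=> /Ninj/eqP; rewrite (negbTE ji).
Qed.

Lemma dual_goldie_dim_rank : dual_goldie_dim R F = rank R F.
Proof.
rewrite /dual_goldie_dim; case: ifPn => [/asboolP[C [infC coC]]|_].
  apply/esym/eq_infty => r.
  (* An infinite coindependent set has finite subsets of every size, so the rank exceeds any real
     [r]. *)
  pose n := (Num.truncn `|r|).+1.
  have [B BC nB] := infinite_set_fset n infC.
  have coB := coC _ BC (finite_fset B).
  have Bn : ([set` B] #= `I_#|` B|)%card by exact/card_eq_fsetP.
  have := coindependent_le_rank Bn coB.
  apply: le_trans; rewrite lee_fin; apply: le_trans (ler_norm r) _.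
  apply: ltW; apply: lt_le_trans (_ : n%:R <= _); last by rewrite ler_nat.
  by rewrite truncnS_gt.
apply/eqP; rewrite eq_le; apply/andP; split.
  apply: ge_ereal_sup => _ [n [C Cn coC] <-].
  exact: coindependent_le_rank Cn coC.
apply: ge_ereal_sup => _ [_ [m [f [S [cf fS ->]]]] <-].
apply: ereal_sup_ubound; exists #|S| => //.
exact: poly_indep_coindependent cf fS.
Qed.

End DualGoldie.

Theorem theoremC (R : realType) (K : fieldType) (F : flow K) :
  ent_star R F = cork R F.
Proof.
rewrite ent_star_rank /cork dual_goldie_dim_rank; last first.
  exact: torsion_free_sub (D_plusE R F).
by rewrite rank_sub// D_plusE.
Qed.
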